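(* Let $V$ be a multiplicative partial isometry (MPI) on a finite dimensional Hilbert space $\mathcal H$ such that its right leg $A$ and its left leg $\hat A$ are ${}^*$-subalgebras of $\mathcal L(\mathcal H)$. Then $V$ is unital, and the expressions $$S(\lambda(\omega))=(\omega\otimes\mathrm{id})(V^* ),\qquad \hat S(\rho(\omega))=(\mathrm{id}\otimes\omega)(V^* )\qquad(\omega\in\mathcal L(\mathcal H)_* )$$ define antipodes $S\colon A\to A$ and $\hat S\colon\hat A\to\hat A$ that make $A$ and $\hat A$, with the coproducts $\Delta$ and $\hat\Delta$, $C^*$-weak Hopf algebras in duality.
   Context: $\mathcal H$ is a finite dimensional complex Hilbert space, $\mathcal L(\mathcal H)$ the algebra of linear operators on $\mathcal H$, $\mathcal L(\mathcal H)_*$ the space of linear functionals on $\mathcal L(\mathcal H)$. Leg notation: $V_{ij}$ acts as $V$ on the $i$-th and $j$-th tensor factors of $\mathcal H\otimes\mathcal H\otimes\mathcal H$ and as the identity on the remaining one. A multiplicative partial isometry (MPI) on $\mathcal H$ is an operator $V\in\mathcal L(\mathcal H\otimes\mathcal H)$ with $VV^*V=V$ and $$V_{23}V_{12}=V_{12}V_{13}V_{23},\quad V_{13}V_{23}V_{23}^*=V_{12}^*V_{12}V_{13},\quad V_{12}V_{12}^*V_{23}=V_{23}V_{12}V_{12}^*,\quad V_{12}V_{23}^*V_{23}=V_{23}^*V_{23}V_{12}.$$ Put $\lambda(\omega)=(\omega\otimes\mathrm{id})(V)$ and $\rho(\omega)=(\mathrm{id}\otimes\omega)(V)$ for $\omega\in\mathcal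 L(\mathcal H)_*$. The right leg of $V$ is $A=\lambda(\mathcal L(\mathcal H)_* )$, the left leg is $\hat A=\rho(\mathcal L(\mathcal H)_* )$; both are subalgebras of $\mathcal L(\mathcal H)$ (not assumed to contain $\mathrm{id}_{\mathcal H}$). They are in duality under the non-degenerate pairing $\langle\lambda(\omega),\rho(\omega')\rangle=(\omega\otimes\omega')(V)$. The maps $\Delta(X)=V(X\otimes\mathrm{id})V^*$ and $\hat\Delta(X)=V^*(\mathrm{id}\otimes X)V$ restrict to coassociative algebra maps $\Delta\colon A\to A\otimes A$, $\hat\Delta\colon\hat A\to\hat A\otimes\hat A$, which are the transposes under the pairing of the multiplications of $\hat A$ and $A$, respectively. $V$ is unital if there exist $\varepsilon,\hat\varepsilon\in\mathcal L(\mathcal H)_*$ such that $\mathbf 1:=\lambda(\hat\varepsilon)\in A$ and $\hat{\mathbf 1}:=\rho(\varepsilon)\in\hat A$ are two-sided units for $A$ and $\hat A$, respectively; the restrictions of $\varepsilon$ to $A$ and of $\hat\varepsilon$ to $\hat A$ are then the counits. Weak bialgebra: a finite dimensional unital algebra $A$ that is also a counital coalgebra $(A,\Delta,\varepsilon)$ such that $\Delta$ is multiplicative, $(\Delta\otimes\mathrm{id})\Delta(\mathbf 1)=(\Delta(\mathbf 1)\otimes\mathbf 1)(\mathbf 1\otimes\Delta(\mathbf 1))=(\mathbf 1\otimes\Delta(\mathbf 1))(\Delta(\mathbf 1)\otimes\mathbf 1)$, and $\varepsilon(xyz)=\varepsilon(xy_{(1)})\varepsilon(y_{(2)}z)=\varepsilon(xy_{(2)})\varepsilon(y_{(1)}z)$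 for all $x,y,z\in A$. Weak Hopf algebra: a weak bialgebra with a linear map $S\colon A\to A$ (the antipode) satisfying $x_{(1)}S(x_{(2)})=\varepsilon(\mathbf 1_{(1)}x)\mathbf 1_{(2)}$, $S(x_{(1)})x_{(2)}=\mathbf 1_{(1)}\varepsilon(x\mathbf 1_{(2)})$ and $S(x_{(1)})x_{(2)}S(x_{(3)})=S(x)$ for all $x$. $C^*$-weak Hopf algebra: a weak Hopf algebra that is a ${}^*$-algebra possessing a faithful ${}^*$-representation on a Hilbert space, with $\Delta$ a ${}^*$-algebra map; here the ${}^*$ on $A$ and $\hat A$ is the adjoint in $\mathcal L(\mathcal H)$. ''In duality'' means that under the pairing $\langle\ ,\ \rangle$ the (co)multiplication, (co)unit and antipode of one are the transposes of the (co-)structure and antipode of the other: $\hat\Delta,\Delta$ transpose to the multiplications, $\varepsilon(x)=\langle x,\hat{\mathbf 1}\rangle$, $\hat\varepsilon(\varphi)=\langle\mathbf 1,\varphi\rangle$, and $\langle S(x),\varphi\rangle=\langle x,\hat S(\varphi)\rangle$. *)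

(* Defs.v *)
From HB Require Import structures.
From mathcomp Require Import all_boot all_order all_algebra.
From mathcomp Require Import reals.
From mathcomp Require Import complex mxtens.

Set Implicit Arguments.
Unset Strict Implicit.
Unset Printing Implicit Defensive.

Import Order.TTheory GRing.Theory Num.Theory.
Local Open Scope ring_scope.
Local Open Scope sesquilinear_scope.

(* The Hilbert space is C^n with its standard inner product, so that L(H) is
   'M[C]_n, composition is *m, and the adjoint is ^t*.  L(H (x) H) is
   'M[C]_(n * n), with a (x) b the Kronecker product a *t b; the pair of basis
   indices (i, j) is encoded by mxtens_index (i, j). *)

Section Tensors.
Variable C : numClosedFieldType.

(* L(C^n)_* *)
Definition functional n := 'Hom('M[C]_n, C^o).

(* (w (x) id)(X) *)
Definition slicel n m (w : 'M[C]_n -> C) (X : 'M[C]_(n * m)) : 'M[C]_m :=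
  \matrix_(j, l) w (\matrix_(i, k) X (mxtens_index (i, j)) (mxtens_index (k, l))).

(* (id (x) w)(X) *)
Definition slicer n m (w : 'M[C]_m -> C) (X : 'M[C]_(n * m)) : 'M[C]_n :=
  \matrix_(i, k) w (\matrix_(j, l) X (mxtens_index (i, j)) (mxtens_index (k, l))).

(* (v (x) w)(X) *)
Definition tensfun n m (v : 'M[C]_n -> C) (w : 'M[C]_m -> C)
  (X : 'M[C]_(n * m)) : C := w (slicel v X).

(* (f (x) g)(X), for linear f and g; the value on the span of the a (x) b with
   a in A and b in B only depends on the restrictions of f to A and g to B. *)
Definition tensmap n m p q (f : 'M[C]_n -> 'M[C]_p) (g : 'M[C]_m -> 'M[C]_q)
  (X : 'M[C]_(n * m)) : 'M[C]_(p * q) :=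
  \sum_(i < n) \sum_(k < n) \sum_(j < m) \sum_(l < m)
    X (mxtens_index (i, j)) (mxtens_index (k, l))
      *: (f (delta_mx i k) *t g (delta_mx j l)).

(* The linear map with a (x) b |-> a b *)
Definition mulop n (X : 'M[C]_(n * n)) : 'M[C]_n :=
  \matrix_(i, l) \sum_(k < n) X (mxtens_index (i, k)) (mxtens_index (k, l)).

(* The canonical identification of L(H (x) (H (x) H)) with
   L((H (x) H) (x) H); both index encodings of a triple (i, j, k) have value
   i * n ^ 2 + j * n + k, so it is a mere cast. *)
Definition assoc3 n (X : 'M[C]_(n * (n * n))) : 'M[C]_(n * n * n) :=
  castmx (mulnA n n n, mulnA n n n) X.

Definition leg12 n (V : 'M[C]_(n * n)) : 'M[C]_(n * n * n) := V *t 1%:M.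

Definition leg23 n (V : 'M[C]_(n * n)) : 'M[C]_(n * n * n) :=
  assoc3 (1%:M *t V).

Definition idx1 n (p : 'I_(n * n * n)) : 'I_n :=
  (mxtens_unindex (mxtens_unindex p).1).1.
Definition idx2 n (p : 'I_(n * n * n)) : 'I_n :=
  (mxtens_unindex (mxtens_unindex p).1).2.
Definition idx3 n (p : 'I_(n * n * n)) : 'I_n := (mxtens_unindex p).2.

Definition leg13 n (V : 'M[C]_(n * n)) : 'M[C]_(n * n * n) :=
  \matrix_(p, q) (V (mxtens_index (idx1 p, idx3 p))
                    (mxtens_index (idx1 q, idx3 q)) *+ (idx2 p == idx2 q)).

Lemma slicel_tens n m (w : functional n) (a : 'M[C]_n) (b : 'M[C]_m) :
  slicel w (a *t b) = w a *: b.
Proof.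
apply/matrixP => j l; rewrite !mxE.
have -> : (\matrix_(i, k) (a *t b) (mxtens_index (i, j)) (mxtens_index (k, l)))
          = b j l *: a.
  by apply/matrixP => i k; rewrite !mxE !mxtens_indexK mulrC.
by rewrite linearZ mulrC.
Qed.

Lemma slicer_tens n m (w : functional m) (a : 'M[C]_n) (b : 'M[C]_m) :
  slicer w (a *t b) = w b *: a.
Proof.
apply/matrixP => i k; rewrite !mxE.
have -> : (\matrix_(j, l) (a *t b) (mxtens_index (i, j)) (mxtens_index (k, l)))
          = a i k *: b.
  by apply/matrixP => j l; rewrite !mxE !mxtens_indexK.
by rewrite linearZ mulrC.
Qed.

Lemma tensfun_tens n m (v : functional n) (w : functional m)
  (a : 'M[C]_n) (b : 'M[C]_m) : tensfun v w (a *t b) = v a * w b.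
Proof. by rewrite /tensfun slicel_tens linearZ. Qed.

Lemma tensmap_tens n m p q
  (f : {linear 'M[C]_n -> 'M[C]_p}) (g : {linear 'M[C]_m -> 'M[C]_q})
  (a : 'M[C]_n) (b : 'M[C]_m) : tensmap f g (a *t b) = f a *t g b.
Proof.
rewrite {2}(matrix_sum_delta a) {2}(matrix_sum_delta b) !linear_sum /=.
apply/matrixP => s t; rewrite /tensmap !mxE !summxE mulr_suml.
apply: eq_bigr => i _; rewrite linear_sum !summxE mulr_suml.
apply: eq_bigr => k _; rewrite summxE mulr_sumr; apply: eq_bigr => j _.
rewrite linear_sum !summxE mulr_sumr; apply: eq_bigr => l _.
by rewrite !linearZ !mxE !mxtens_indexK mulrACA.
Qed.

Lemma mulop_tens n (a b : 'M[C]_n) : mulop (a *t b) = a *m b.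
Proof.
apply/matrixP => i l; rewrite !mxE; apply: eq_bigr => k _.
by rewrite !mxE !mxtens_indexK.
Qed.

Lemma leg13_tens n (a b : 'M[C]_n) : leg13 (a *t b) = a *t 1%:M *t b.
Proof.
apply/matrixP => p q; rewrite !mxE !mxtens_indexK /=.
by rewrite mulrnAr mulr1 mulrnAl.
Qed.

Lemma leg23_tens n (a b : 'M[C]_n) : leg23 (a *t b) = 1%:M *t a *t b.
Proof.
apply/matrixP => p q; rewrite castmxE.
case: (mxtens_indexP p) => p' p3; case: (mxtens_indexP p') => p1 p2.
case: (mxtens_indexP q) => q' q3; case: (mxtens_indexP q') => q1 q2.
have E (i j k : 'I_n) : cast_ord (esym (mulnA n n n))
    (mxtens_index (mxtens_index (i, j), k)) =
    mxtens_index (i, mxtens_index (j, k)).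
  by apply: val_inj => /=; rewrite mulnDl mulnA addnA.
by rewrite /= !E !tensmxE mulrA.
Qed.

End Tensors.

Section Algebras.
Variables (C : numClosedFieldType) (n : nat).
Implicit Types (A B : {vspace 'M[C]_n}) (e : 'M[C]_n).

Definition subalgebra A :=
  forall x y, x \in A -> y \in A -> x *m y \in A.

Definition star_subalgebra A :=
  subalgebra A /\ (forall x, x \in A -> x^t* \in A).

Definition is_unit A e :=
  e \in A /\ (forall x, x \in A -> e *m x = x /\ x *m e = x).

Definition tensv A B : {vspace 'M[C]_(n * n)} :=
  <<[seq a *t b | a <- vbasis A, b <- vbasis B]>>%VS.

(* A faithful *-representation of the *-algebra A; every linear map on A is the
   restriction of one on 'M[C]_n.  As A need not contain the identity matrix,
   it is an injective *-homomorphism, not required to preserve units. *)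
Definition has_faithful_star_rep A :=
  exists (m : nat) (pi : 'Hom('M[C]_n, 'M[C]_m)),
    [/\ forall x y, x \in A -> y \in A -> pi (x *m y) = pi x *m pi y,
        forall x, x \in A -> pi (x^t*) = (pi x)^t*
      & forall x, x \in A -> pi x = 0 -> x = 0].

(* An algebra, realized as a subspace of a matrix algebra, with a unit, a
   coproduct, a counit and an antipode.  The last three are linear maps on
   the carrier; they are represented by linear maps on the whole matrix
   algebra, only the restrictions of which to the carrier are relevant. *)
Record hopf_data := HopfData {
  carrier : {vspace 'M[C]_n};
  unit_el : 'M[C]_n;
  comul : {linear 'M[C]_n -> 'M[C]_(n * n)};
  counit : functional C n;
  antipode : 'End('M[C]_n) }.

Section HopfPredicates.
Variable H : hopf_data.
Local Notation A := (carrier H).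
Local Notation "1H" := (unit_el H).
Local Notation D := (comul H).
Local Notation eps := (counit H).
Local Notation S := (antipode H).

Definition is_unital_algebra := subalgebra A /\ is_unit A 1H.

Definition is_counital_coalgebra :=
  [/\ forall x, x \in A -> D x \in tensv A A,
      forall x, x \in A -> tensmap D id (D x) = assoc3 (tensmap id D (D x)),
      forall x, x \in A -> slicel eps (D x) = x
    & forall x, x \in A -> slicer eps (D x) = x].

Definition is_weak_bialgebra :=
  [/\ is_unital_algebra,
      is_counital_coalgebra,
      forall x y, x \in A -> y \in A -> D (x *m y) = D x *m D y,
      tensmap D id (D 1H) = (D 1H *t 1H) *m assoc3 (1H *t D 1H) /\
      tensmap D id (D 1H) = assoc3 (1H *t D 1H) *m (D 1H *t 1H)
    & forall x y z, x \in A -> y \in A -> z \in A ->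
      (* eps (x y_1) eps (y_2 z) and eps (x y_2) eps (y_1 z) *)
      eps (x *m y *m z)
        = tensfun (fun u => eps (x *m u)) (fun u => eps (u *m z)) (D y) /\
      eps (x *m y *m z)
        = tensfun (fun u => eps (u *m z)) (fun u => eps (x *m u)) (D y)].

(* x_1 S(x_2) = eps (1_1 x) 1_2,  S(x_1) x_2 = 1_1 eps (x 1_2),
   S(x_1) x_2 S(x_3) = S(x) *)
Definition is_weak_hopf_algebra :=
  [/\ is_weak_bialgebra,
      forall x, x \in A -> S x \in A,
      forall x, x \in A ->
        mulop (tensmap id S (D x)) = slicel (fun u => eps (u *m x)) (D 1H),
      forall x, x \in A ->
        mulop (tensmap S id (D x)) = slicer (fun u => eps (x *m u)) (D 1H)
    & forall x, x \in A ->
        mulop (tensmap (fun X => mulop (tensmap S id X)) S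
                 (tensmap D id (D x))) = S x].

Definition is_cstar_weak_hopf_algebra :=
  [/\ is_weak_hopf_algebra,
      star_subalgebra A,
      has_faithful_star_rep A
    & forall x, x \in A -> D (x^t*) = (D x)^t*].

End HopfPredicates.

(* Only the restriction of the bilinear form P to the carriers is relevant. *)
Definition in_duality (P : 'Hom('M[C]_n, functional C n)) (H K : hopf_data) :=
  let A := carrier H in let B := carrier K in
  [/\ (forall x, x \in A -> (forall f, f \in B -> P x f = 0) -> x = 0) /\
      (forall f, f \in B -> (forall x, x \in A -> P x f = 0) -> f = 0),
      forall x f g, x \in A -> f \in B -> g \in B ->
        P x (f *m g) = tensfun (fun u => P u f) (fun u => P u g) (comul H x),
      forall x y f, x \in A -> y \in A -> f \in B ->
        P (x *m y) f = tensfun (P x) (P y) (comul K f),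
      (forall x, x \in A -> counit H x = P x (unit_el K)) /\
      (forall f, f \in B -> counit K f = P (unit_el H) f)
    & forall x f, x \in A -> f \in B -> P (antipode H x) f = P x (antipode K f)].

End Algebras.

Section MultiplicativePartialIsometries.
Variables (C : numClosedFieldType) (n : nat).
Implicit Types V : 'M[C]_(n * n).

Definition is_MPI V :=
  let V12 := leg12 V in let V13 := leg13 V in let V23 := leg23 V in
  V *m V^t* *m V = V /\
  [/\ V23 *m V12 = V12 *m V13 *m V23,
      V13 *m V23 *m V23^t* = V12^t* *m V12 *m V13,
      V12 *m V12^t* *m V23 = V23 *m V12 *m V12^t*
    & V12 *m V23^t* *m V23 = V23^t* *m V23 *m V12].

Definition lambda V (w : functional C n) : 'M[C]_n := slicel w V.
Definition rho V (w : functional C n) : 'M[C]_n := slicer w V.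

Lemma lambda_linear V : linear (lambda V).
Proof.
by move=> c u v; apply/matrixP => j l; rewrite !mxE add_lfunE scale_lfunE.
Qed.
HB.instance Definition _ V :=
  GRing.isLinear.Build C (functional C n) 'M[C]_n _ (lambda V)
    (lambda_linear V).

Lemma rho_linear V : linear (rho V).
Proof.
by move=> c u v; apply/matrixP => j l; rewrite !mxE add_lfunE scale_lfunE.
Qed.
HB.instance Definition _ V :=
  GRing.isLinear.Build C (functional C n) 'M[C]_n _ (rho V) (rho_linear V).

Definition right_leg V : {vspace 'M[C]_n} := limg (linfun (lambda V)).
Definition left_leg V : {vspace 'M[C]_n} := limg (linfun (rho V)).

Lemma right_legP V x :
  reflect (exists w, x = lambda V w) (x \in right_leg V).
Proof.
apply: (iffP memv_imgP) => [[w _ ->]|[w ->]]; exists w; rewrite ?lfunE //.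
exact: memvf.
Qed.

Lemma left_legP V x : reflect (exists w, x = rho V w) (x \in left_leg V).
Proof.
apply: (iffP memv_imgP) => [[w _ ->]|[w ->]]; exists w; rewrite ?lfunE //.
exact: memvf.
Qed.

Definition Delta V (X : 'M[C]_n) : 'M[C]_(n * n) :=
  V *m (X *t 1%:M) *m V^t*.
Definition Deltah V (X : 'M[C]_n) : 'M[C]_(n * n) :=
  V^t* *m (1%:M *t X) *m V.

Lemma Delta_linear V : linear (Delta V).
Proof.
move=> c x y; rewrite /Delta.
have -> : (c *: x + y) *t 1%:M = c *: (x *t 1%:M) + y *t 1%:M
    :> 'M[C]_(n * n).
  by apply/matrixP => i j; rewrite !mxE mulrDl mulrA.
by rewrite mulmxDr mulmxDl -scalemxAr -scalemxAl.
Qed.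
HB.instance Definition _ V :=
  GRing.isLinear.Build C 'M[C]_n 'M[C]_(n * n) _ (Delta V) (Delta_linear V).

Lemma Deltah_linear V : linear (Deltah V).
Proof.
move=> c x y; rewrite /Deltah.
have -> : 1%:M *t (c *: x + y) = c *: (1%:M *t x) + 1%:M *t y
    :> 'M[C]_(n * n).
  by apply/matrixP => i j; rewrite !mxE mulrDr mulrCA.
by rewrite mulmxDr mulmxDl -scalemxAr -scalemxAl.
Qed.
HB.instance Definition _ V :=
  GRing.isLinear.Build C 'M[C]_n 'M[C]_(n * n) _ (Deltah V) (Deltah_linear V).

(* Note the crossing: the unit of the right leg is lambda(epsh) and that of the
   left leg is rho(eps), while eps restricts to the counit of the right leg and
   epsh to that of the left leg. *)
Definition unit_functionals V (eps epsh : functional C n) :=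
  is_unit (right_leg V) (lambda V epsh) /\ is_unit (left_leg V) (rho V eps).

Definition unital V := exists eps epsh, unit_functionals V eps epsh.

Definition right_leg_data V (eps epsh : functional C n) (S : 'End('M[C]_n)) :=
  HopfData (right_leg V) (lambda V epsh) (Delta V) eps S.

Definition left_leg_data V (eps epsh : functional C n) (Sh : 'End('M[C]_n)) :=
  HopfData (left_leg V) (rho V eps) (Deltah V) epsh Sh.

(* <lambda(w), rho(w')> = (w (x) w')(V) *)
Definition is_leg_pairing V (P : 'Hom('M[C]_n, functional C n)) :=
  forall w w' : functional C n, P (lambda V w) (rho V w') = tensfun w w' V.

End MultiplicativePartialIsometries.

(* Main.v *)
Require Import Defs.
From HB Require Import structures.
From mathcomp Require Import all_boot all_order all_algebra.
From mathcomp Require Import reals.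
From mathcomp Require Import complex mxtens.
From mathcomp Require Import ring.

(** The whole structure is read off from an expansion of V as a sum of
    b_i (x) a_i with b_i in the left leg and a_i in the right leg.  Then
    lambda(w) is the sum of the w(b_i) a_i and rho(w) that of the w(a_i) b_i,
    so the two legs enter symmetrically, and
      Delta(lambda(w))  = sum of w(b_i b_j) a_i (x) a_j,
      Deltah(rho(w))    = sum of w(a_i a_j) b_i (x) b_j,
    which follow from the pentagon equation and the second relation
    V13 V23 V23^t* = V12^t* V12 V13 (Delta_dual, Deltah_dual).  Each coproduct
    is thereby the transpose of the product of the other leg.
    Coassociativity and the counit laws are then formal, and convolution
    becomes multiplication in the tensor square: the identity of a leg is
    represented by V and the antipode by its adjoint, so id * S, S * id and
    S * id * S are represented by V V^t*, V^t* V and V^t* V V^t* = V^t*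
    (dual_coproduct_convolution).

    A star-subalgebra of matrices has a self-adjoint unit
    (star_subalgebra_unit), which makes V unital.  Slicing the second relation
    on its first and on its third leg shows that V V^t* has its first leg in
    the right leg of V and that V^t* V has its second leg in the left leg of V.
    Hence the unit of each leg is also neutral for the other leg
    (unit_mul_left_leg, unit_mul_right_leg).  So Delta(1) = V V^t* and
    Deltah(1) = V^t* V, and the last two relations, which let these projections
    commute with V on the adjacent legs, become the comultiplicativity of the
    units (weak_unit_right, weak_unit_left).  Weak multiplicativity of the
    counit of one leg is the transpose of that property of the unit of the
    other leg (dual_weak_counit).

    It remains to identify id * S and S * id with the counital maps.  The
    second relation gives this directly for S * id on the right leg and for
    id * S on the left leg (source_right, target_left); as the counital maps of
    the two legs are transposes of each other (target_counit_dual,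
    source_counit_dual), the other two cases follow (target_right,
    source_left). *)

Set Implicit Arguments.
Unset Strict Implicit.
Unset Printing Implicit Defensive.

Import Order.TTheory GRing.Theory Num.Theory.
Local Open Scope ring_scope.
Local Open Scope sesquilinear_scope.

(** * Tensors, slices and legs as linear maps *)

Section TensorCalculus.
Variable C : numClosedFieldType.

Lemma adjmxM m n p (A : 'M[C]_(m, n)) (B : 'M[C]_(n, p)) :
  (A *m B)^t* = B^t* *m A^t*.
Proof. by rewrite trmx_mul map_mxM. Qed.

Lemma adjmx1 m : (1%:M : 'M[C]_m)^t* = 1%:M.
Proof. by rewrite trmx1 map_mx1. Qed.

Lemma adjmx_sum m n I (r : seq I) (F : I -> 'M[C]_(m, n)) :
  (\sum_(i <- r) F i)^t* = \sum_(i <- r) (F i)^t*.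
Proof. by rewrite !raddf_sum /=. Qed.

Lemma adjmx_tens m n p q (A : 'M[C]_(m, n)) (B : 'M[C]_(p, q)) :
  (A *t B)^t* = A^t* *t B^t*.
Proof. by rewrite trmx_tens map_mxT. Qed.

Lemma tensmx_suml m n p q I (r : seq I) (F : I -> 'M[C]_(m, n))
  (B : 'M[C]_(p, q)) : (\sum_(i <- r) F i) *t B = \sum_(i <- r) F i *t B.
Proof.
by apply/matrixP => i j; rewrite !mxE !summxE mulr_suml;
   apply: eq_bigr => k _; rewrite !mxE.
Qed.

Lemma tensmx_sumr m n p q I (r : seq I) (A : 'M[C]_(m, n))
  (F : I -> 'M[C]_(p, q)) : A *t (\sum_(i <- r) F i) = \sum_(i <- r) A *t F i.
Proof.
by apply/matrixP => i j; rewrite !mxE !summxE mulr_sumr;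
   apply: eq_bigr => k _; rewrite !mxE.
Qed.

Lemma tensmxZl m n p q c (A : 'M[C]_(m, n)) (B : 'M[C]_(p, q)) :
  (c *: A) *t B = c *: (A *t B).
Proof. by apply/matrixP => i j; rewrite !mxE mulrA. Qed.

Lemma tensmxZr m n p q c (A : 'M[C]_(m, n)) (B : 'M[C]_(p, q)) :
  A *t (c *: B) = c *: (A *t B).
Proof. by apply/matrixP => i j; rewrite !mxE mulrCA. Qed.

Lemma tensmx11 m n : 1%:M *t 1%:M = 1%:M :> 'M[C]_(m * n).
Proof.
apply/matrixP => s t; case: (mxtens_indexP s) => i j.
case: (mxtens_indexP t) => k l; rewrite tensmxE !mxE.
by rewrite (can_eq (@mxtens_indexK m n)) xpair_eqE -natrM mulnb.
Qed.

Lemma functionalD n (w : functional C n) c X Y :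
  w (c *: X + Y) = c * w X + w Y.
Proof. exact: linearP. Qed.

Lemma slicel_linear n m (w : functional C n) : linear (@slicel C n m w).
Proof.
move=> c X Y; apply/matrixP => j l; rewrite !mxE -functionalD; congr (w _).
by apply/matrixP => i k; rewrite !mxE.
Qed.
HB.instance Definition _ n m (w : functional C n) :=
  GRing.isLinear.Build C 'M[C]_(n * m) 'M[C]_m _ (slicel w)
    (@slicel_linear n m w).

Lemma slicer_linear n m (w : functional C m) : linear (@slicer C n m w).
Proof.
move=> c X Y; apply/matrixP => j l; rewrite !mxE -functionalD; congr (w _).
by apply/matrixP => i k; rewrite !mxE.
Qed.
HB.instance Definition _ n m (w : functional C m) :=
  GRing.isLinear.Build C 'M[C]_(n * m) 'M[C]_n _ (slicer w)
    (@slicer_linear n m w).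

Lemma tensfun_linear n m (v : functional C n) (w : functional C m) :
  linear (tensfun v w : _ -> C^o).
Proof. by move=> c X Y; rewrite /tensfun !linearP. Qed.
HB.instance Definition _ n m (v : functional C n) (w : functional C m) :=
  GRing.isLinear.Build C 'M[C]_(n * m) C^o _ (tensfun v w)
    (@tensfun_linear n m v w).

Lemma tensmap_linear n m p q (f : 'M[C]_n -> 'M[C]_p) (g : 'M[C]_m -> 'M[C]_q) :
  linear (tensmap f g).
Proof.
move=> c X Y; rewrite /tensmap; do 4 (rewrite scaler_sumr -big_split /=;
  apply: eq_bigr => ? _).
by rewrite !mxE scalerDl scalerA.
Qed.
HB.instance Definition _ n m p q (f : 'M[C]_n -> 'M[C]_p)
    (g : 'M[C]_m -> 'M[C]_q) :=
  GRing.isLinear.Build C 'M[C]_(n * m) 'M[C]_(p * q) _ (tensmap f g)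
    (@tensmap_linear n m p q f g).

Lemma mulop_linear n : linear (@mulop C n).
Proof.
move=> c X Y; apply/matrixP => i j; rewrite !mxE mulr_sumr -big_split /=.
by apply: eq_bigr => k _; rewrite !mxE.
Qed.
HB.instance Definition _ n :=
  GRing.isLinear.Build C 'M[C]_(n * n) 'M[C]_n _ (@mulop C n)
    (@mulop_linear n).

Lemma assoc3_linear n : linear (@assoc3 C n).
Proof.
by move=> c X Y; apply/matrixP => i j; rewrite !(castmxE, mxE).
Qed.
HB.instance Definition _ n :=
  GRing.isLinear.Build C 'M[C]_(n * (n * n)) 'M[C]_(n * n * n) _ (@assoc3 C n)
    (@assoc3_linear n).

Lemma leg12_linear n : linear (@leg12 C n).
Proof. by move=> c X Y; apply/matrixP => i j; rewrite !mxE mulrDl mulrA. Qed.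
HB.instance Definition _ n :=
  GRing.isLinear.Build C 'M[C]_(n * n) 'M[C]_(n * n * n) _ (@leg12 C n)
    (@leg12_linear n).

Lemma leg13_linear n : linear (@leg13 C n).
Proof.
by move=> c X Y; apply/matrixP => i j; rewrite !mxE mulrnDl mulrnAr.
Qed.
HB.instance Definition _ n :=
  GRing.isLinear.Build C 'M[C]_(n * n) 'M[C]_(n * n * n) _ (@leg13 C n)
    (@leg13_linear n).

Lemma leg23_linear n : linear (@leg23 C n).
Proof.
move=> c X Y; rewrite /leg23 -assoc3_linear; congr assoc3.
by apply/matrixP => i j; rewrite !mxE mulrDr mulrCA.
Qed.
HB.instance Definition _ n :=
  GRing.isLinear.Build C 'M[C]_(n * n) 'M[C]_(n * n * n) _ (@leg23 C n)
    (@leg23_linear n).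

Lemma assoc3_tens n (a b c : 'M[C]_n) : assoc3 (a *t (b *t c)) = a *t b *t c.
Proof.
apply/matrixP => p q; rewrite castmxE.
case: (mxtens_indexP p) => p' p3; case: (mxtens_indexP p') => p1 p2.
case: (mxtens_indexP q) => q' q3; case: (mxtens_indexP q') => q1 q2.
have E (i j k : 'I_n) : cast_ord (esym (mulnA n n n))
    (mxtens_index (mxtens_index (i, j), k)) =
    mxtens_index (i, mxtens_index (j, k)).
  by apply: val_inj => /=; rewrite mulnDl mulnA addnA.
by rewrite /= !E !tensmxE mulrA.
Qed.

(** Bilinear identities on a tensor product need only be checked on pure
    tensors, by expanding their arguments along such sums. *)
Lemma tens_decomp n m (X : 'M[C]_(n * m)) :
  exists (I : finType) (f : I -> 'M[C]_n) (g : I -> 'M[C]_m),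
    X = \sum_i f i *t g i.
Proof.
exists ('I_n * 'I_n)%type, (fun p => delta_mx p.1 p.2),
  (fun p => \matrix_(j, l) X (mxtens_index (p.1, j)) (mxtens_index (p.2, l))).
apply/matrixP => s t; rewrite summxE.
case: (mxtens_indexP s) => i j; case: (mxtens_indexP t) => k l.
rewrite (bigD1 (i, k)) //= big1 => [|[i' k'] /= ne].
  by rewrite tensmxE !mxE !eqxx mul1r addr0.
rewrite tensmxE !mxE; move: ne; rewrite xpair_eqE eq_sym [k' == k]eq_sym.
by move/negbTE => ->; rewrite mul0r.
Qed.

End TensorCalculus.

(** * Coproducts that are transposes of products *)

Section Contractions.
Variables (C : numClosedFieldType) (n : nat).
Implicit Types (w : functional C n) (x y z : 'M[C]_n).

Definition rmulf w y : functional C n := (w \o linfun (mulmxr y))%VF.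
Definition lmulf w y : functional C n := (w \o linfun (mulmx y))%VF.

Lemma rmulfE w y u : rmulf w y u = w (u *m y).
Proof. by rewrite comp_lfunE lfunE. Qed.

Lemma lmulfE w y u : lmulf w y u = w (y *m u).
Proof. by rewrite comp_lfunE lfunE. Qed.

Lemma eq_slicel m (f g : 'M[C]_n -> C) (X : 'M[C]_(n * m)) :
  f =1 g -> slicel f X = slicel g X.
Proof. by move=> E; apply/matrixP => i j; rewrite !mxE E. Qed.

Lemma eq_slicer m (f g : 'M[C]_n -> C) (X : 'M[C]_(m * n)) :
  f =1 g -> slicer f X = slicer g X.
Proof. by move=> E; apply/matrixP => i j; rewrite !mxE E. Qed.

Lemma eq_tensfun (f f' g g' : 'M[C]_n -> C) (X : 'M[C]_(n * n)) :
  f =1 f' -> g =1 g' -> tensfun f g X = tensfun f' g' X.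
Proof. by move=> ff gg; rewrite /tensfun (eq_slicel _ ff) gg. Qed.

Lemma functional_sum w (I : finType) (F : I -> 'M[C]_n) :
  w (\sum_i F i) = \sum_i w (F i).
Proof. exact: linear_sum. Qed.

Lemma functionalZ w c x : w (c *: x) = c * w x.
Proof. exact: linearZ. Qed.

Lemma tensmap_tensl (f : {linear 'M[C]_n -> 'M[C]_(n * n)}) x y :
  tensmap f id (x *t y) = f x *t y.
Proof. exact: (tensmap_tens f idfun). Qed.

Lemma tensmap_tensr (f : {linear 'M[C]_n -> 'M[C]_(n * n)}) x y :
  tensmap id f (x *t y) = x *t f y.
Proof. exact: (tensmap_tens idfun f). Qed.

Section Contract.
Variables (I : finType) (b a : I -> 'M[C]_n).

(** If X is the sum of the b_i (x) a_i, this is the slice of X by w on the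
    first leg.  Keeping the two families instead of X makes the exchange of the
    legs a mere exchange of arguments. *)
Definition contract w := \sum_i w (b i) *: a i.

Lemma slicel_sum_tens w : slicel w (\sum_i b i *t a i) = contract w.
Proof.
by rewrite linear_sum; apply: eq_bigr => i _; rewrite /= slicel_tens.
Qed.

Lemma slicer_sum_tens w : slicer w (\sum_i a i *t b i) = contract w.
Proof.
by rewrite linear_sum; apply: eq_bigr => i _; rewrite /= slicer_tens.
Qed.

End Contract.

Lemma tensfunZ (v w : functional C n) c (X : 'M[C]_(n * n)) :
  tensfun v w (c *: X) = c * tensfun v w X.
Proof. exact: linearZ. Qed.

(** The middle leg is the only one on which the two factors meet. *)
Lemma tensfun3_leg1223 (w1 w2 w3 : functional C n) (X Y : 'M[C]_(n * n)) :
  tensfun w1 w2 (slicer w3 (leg12 X *m leg23 Y))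
    = w2 (slicel w1 X *m slicer w3 Y).
Proof.
have [I [f [g ->]]] := tens_decomp X; have [J [h [k ->]]] := tens_decomp Y.
rewrite slicel_sum_tens slicer_sum_tens /contract.
rewrite [leg12 _]linear_sum [leg23 _]linear_sum /=.
rewrite !mulmx_suml functional_sum [slicer _ _]linear_sum [LHS]linear_sum.
apply: eq_bigr => i _ /=; rewrite !mulmx_sumr functional_sum.
rewrite [slicer _ _]linear_sum [LHS]linear_sum; apply: eq_bigr => j _ /=.
rewrite leg23_tens !tensmx_mul !mul1mx !mulmx1 slicer_tens /=.
by rewrite tensfunZ tensfun_tens -scalemxAl -scalemxAr !functionalZ mulrCA.
Qed.

Lemma tensfun3_leg2312 (w1 w2 w3 : functional C n) (X Y : 'M[C]_(n * n)) :
  tensfun w1 w2 (slicer w3 (leg23 Y *m leg12 X))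
    = w2 (slicer w3 Y *m slicel w1 X).
Proof.
have [I [f [g ->]]] := tens_decomp X; have [J [h [k ->]]] := tens_decomp Y.
rewrite slicel_sum_tens slicer_sum_tens /contract.
rewrite [leg12 _]linear_sum [leg23 _]linear_sum /=.
rewrite !mulmx_suml functional_sum [slicer _ _]linear_sum [LHS]linear_sum.
apply: eq_bigr => i _ /=; rewrite !mulmx_sumr functional_sum.
rewrite [slicer _ _]linear_sum [LHS]linear_sum; apply: eq_bigr => j _ /=.
rewrite leg23_tens !tensmx_mul !mul1mx !mulmx1 slicer_tens /=.
by rewrite tensfunZ tensfun_tens -scalemxAl -scalemxAr !functionalZ mulrCA.
Qed.

(** For V the sum of the b_i (x) a_i, both sides are (u (x) w)(V), the
    pairing of the two slices. *)
Lemma contractC (I : finType) (b a : I -> 'M[C]_n) (u w : functional C n) :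
  w (contract b a u) = u (contract a b w).
Proof.
rewrite !functional_sum; apply: eq_bigr => i _.
by rewrite !functionalZ mulrC.
Qed.

Section DualCoproduct.
Variables (I : finType) (b a : I -> 'M[C]_n).

(** Under the pairing in which contract b a w pairs with y as w(y), this says
    that D is the transpose of the multiplication of the b_i. *)
Definition dual_coproduct (D : 'M[C]_n -> 'M[C]_(n * n)) :=
  forall w, D (contract b a w)
    = \sum_i \sum_j w (b i *m b j) *: (a i *t a j).

Variable D : {linear 'M[C]_n -> 'M[C]_(n * n)}.
Hypothesis DE : dual_coproduct D.

Lemma dual_coproduct_sliceL w :
  D (contract b a w) = \sum_i a i *t contract b a (lmulf w (b i)).
Proof.
rewrite DE; apply: eq_bigr => i _; rewrite tensmx_sumr.
by apply: eq_bigr => j _; rewrite tensmxZr lmulfE.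
Qed.

Lemma dual_coproduct_sliceR w :
  D (contract b a w) = \sum_j contract b a (rmulf w (b j)) *t a j.
Proof.
rewrite DE exchange_big; apply: eq_bigr => j _; rewrite tensmx_suml.
by apply: eq_bigr => i _; rewrite tensmxZl rmulfE.
Qed.

(** The right-hand side is symmetric in the two ways of iterating, which is
    coassociativity. *)
Lemma dual_coproduct_iter w :
  tensmap D id (D (contract b a w))
    = \sum_i \sum_j \sum_k w (b i *m b j *m b k) *: (a i *t a j *t a k).
Proof.
rewrite dual_coproduct_sliceR linear_sum.
under eq_bigr => k _ do rewrite /= tensmap_tensl DE tensmx_suml.
rewrite exchange_big; apply: eq_bigr => i _.
under eq_bigr => k _ do rewrite tensmx_suml.
rewrite exchange_big; apply: eq_bigr => j _.
by apply: eq_bigr => k _; rewrite tensmxZl rmulfE.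
Qed.

Lemma dual_coproduct_coassoc w :
  tensmap D id (D (contract b a w))
    = assoc3 (tensmap id D (D (contract b a w))).
Proof.
rewrite dual_coproduct_iter dual_coproduct_sliceL.
rewrite [X in assoc3 X]linear_sum linear_sum; apply: eq_bigr => i _.
rewrite /= tensmap_tensr DE tensmx_sumr.
rewrite linear_sum; apply: eq_bigr => j _; rewrite tensmx_sumr linear_sum.
apply: eq_bigr => k _; rewrite /= tensmxZr linearZ /= assoc3_tens lmulfE.
by rewrite mulmxA.
Qed.

(** The functional eps pairs with the a_i as the element contract a b eps
    does, so the counit law is the unit law of that element, transposed. *)
Lemma dual_coproduct_counitl eps w :
  (forall i, contract a b eps *m b i = b i) ->
  slicel eps (D (contract b a w)) = contract b a w.
Proof.
move=> unitl; rewrite dual_coproduct_sliceR linear_sum.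
apply: eq_bigr => j _; rewrite /= slicel_tens contractC rmulfE unitl //.
Qed.

Lemma dual_coproduct_counitr eps w :
  (forall i, b i *m contract a b eps = b i) ->
  slicer eps (D (contract b a w)) = contract b a w.
Proof.
move=> unitr; rewrite dual_coproduct_sliceL linear_sum.
apply: eq_bigr => j _; rewrite /= slicer_tens contractC lmulfE unitr //.
Qed.

(** A map f with f(lambda(u)) = (u (x) id)(X) is represented by X; here X is
    the sum of the p_j (x) q_j, and g is likewise represented by the sum Y of
    the r_k (x) s_k.  Since D is dual to the product on the first leg, the
    convolution of f and g is represented by the product X Y. *)
Lemma dual_coproduct_convolution (J K : finType) (p q : J -> 'M[C]_n)
    (r s : K -> 'M[C]_n) (f g : {linear 'M[C]_n -> 'M[C]_n}) w :
  (forall u, f (contract b a u) = contract p q u) ->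
  (forall u, g (contract b a u) = contract r s u) ->
  mulop (tensmap f g (D (contract b a w)))
    = \sum_j \sum_k w (p j *m r k) *: (q j *m s k).
Proof.
move=> hf hg; transitivity (\sum_k contract p q (rmulf w (r k)) *m s k).
  transitivity (\sum_i f (a i) *m g (contract b a (lmulf w (b i)))).
    rewrite dual_coproduct_sliceL [X in mulop X]linear_sum linear_sum /=.
    apply: eq_bigr => i _.
    by rewrite tensmap_tens mulop_tens.
  under eq_bigr => i _ do rewrite hg mulmx_sumr.
  rewrite exchange_big; apply: eq_bigr => k _.
  rewrite -hf linear_sum mulmx_suml; apply: eq_bigr => i _.
  by rewrite -scalemxAr linearZ /= -scalemxAl lmulfE rmulfE.
rewrite exchange_big; apply: eq_bigr => k _.
rewrite mulmx_suml; apply: eq_bigr => i _.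
by rewrite -scalemxAl rmulfE.
Qed.

End DualCoproduct.

Section DualPair.
Variables (I : finType) (b a : I -> 'M[C]_n).
Variables D Dh : {linear 'M[C]_n -> 'M[C]_(n * n)}.
Hypotheses (DE : dual_coproduct b a D) (DhE : dual_coproduct a b Dh).
Variables eps epsh : functional C n.

Local Notation lam := (contract b a).
Local Notation rh := (contract a b).

(** Both sides are the sum of the
    epsh(b_i b_k) w'(a_k) eps(a_i a_j) w(b_j): the maps
    x |-> eps(1_1 x) 1_2 of the two members of a dual pair are transposes of
    each other. *)
Lemma target_counit_dual w w' :
  w' (slicel (fun u => eps (u *m lam w)) (D (lam epsh)))
  = w (slicel (fun u => epsh (u *m rh w')) (Dh (rh eps))).
Proof.
rewrite (@eq_slicel _ _ (rmulf eps (lam w))) => [|u]; last by rewrite rmulfE.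
rewrite (@eq_slicel _ (fun u => epsh _) (rmulf epsh (rh w'))) => [|u];
  last by rewrite rmulfE.
rewrite (dual_coproduct_sliceL DE) (dual_coproduct_sliceL DhE).
rewrite [slicel (rmulf eps _) _]linear_sum [slicel (rmulf epsh _) _]linear_sum.
transitivity (\sum_i \sum_k epsh (b i *m b k) * eps (a i *m lam w) * w' (a k)).
  rewrite functional_sum; apply: eq_bigr => i _; rewrite /= slicel_tens rmulfE.
  rewrite functionalZ functional_sum mulr_sumr; apply: eq_bigr => k _.
  by rewrite functionalZ lmulfE mulrCA mulrA.
transitivity (\sum_i \sum_k \sum_j
   epsh (b i *m b k) * w' (a k) * (eps (a i *m a j) * w (b j))).
  apply: eq_bigr => i _; apply: eq_bigr => k _.
  rewrite mulmx_sumr functional_sum mulr_sumr mulr_suml; apply: eq_bigr => j _.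
  rewrite -scalemxAr functionalZ [w _ * _]mulrC -!mulrA; congr (_ * _).
  by rewrite mulrA mulrC.
rewrite functional_sum; apply: eq_bigr => i _; rewrite /= slicel_tens rmulfE.
rewrite functionalZ mulmx_sumr !functional_sum mulr_suml.
apply: eq_bigr => k _; rewrite mulr_sumr; apply: eq_bigr => j _.
by rewrite -scalemxAr !functionalZ lmulfE [w' _ * _]mulrC.
Qed.

(** The mirror image of the previous lemma, for x |-> 1_1 eps(x 1_2). *)
Lemma source_counit_dual w w' :
  w' (slicer (fun u => eps (lam w *m u)) (D (lam epsh)))
  = w (slicer (fun u => epsh (rh w' *m u)) (Dh (rh eps))).
Proof.
rewrite (@eq_slicer _ _ (lmulf eps (lam w))) => [|u]; last by rewrite lmulfE.
rewrite (@eq_slicer _ (fun u => epsh _) (lmulf epsh (rh w'))) => [|u];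
  last by rewrite lmulfE.
rewrite (dual_coproduct_sliceR DE) (dual_coproduct_sliceR DhE).
rewrite [slicer (lmulf eps _) _]linear_sum [slicer (lmulf epsh _) _]linear_sum.
transitivity (\sum_i \sum_k \sum_j
   epsh (b k *m b i) * w' (a k) * (eps (a j *m a i) * w (b j))).
  rewrite functional_sum; apply: eq_bigr => i _; rewrite /= slicer_tens lmulfE.
  rewrite functionalZ mulmx_suml !functional_sum mulr_suml exchange_big.
  apply: eq_bigr => k _; rewrite mulr_sumr; apply: eq_bigr => j _.
  rewrite -scalemxAl !functionalZ rmulfE [RHS]mulrC; congr (_ * _).
  by rewrite mulrC.
rewrite functional_sum; apply: eq_bigr => i _; rewrite /= slicer_tens lmulfE.
rewrite functionalZ mulmx_suml !functional_sum mulr_suml.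
apply: eq_bigr => k _; rewrite mulr_sumr; apply: eq_bigr => j _.
by rewrite -scalemxAl !functionalZ rmulfE [w' _ * _]mulrC.
Qed.

Lemma slicel_dual_counit w :
  slicel w (Dh (rh eps)) = rh (lmulf eps (lam w)).
Proof.
rewrite (dual_coproduct_sliceR DhE) linear_sum; apply: eq_bigr => j _.
by rewrite /= slicel_tens contractC rmulfE lmulfE.
Qed.

Lemma slicer_dual_counit w :
  slicer w (Dh (rh eps)) = rh (rmulf eps (lam w)).
Proof.
rewrite (dual_coproduct_sliceL DhE) linear_sum; apply: eq_bigr => j _.
by rewrite /= slicer_tens contractC rmulfE lmulfE.
Qed.

Lemma tensfun_dual_coproduct (u v w : functional C n) :
  tensfun u v (D (lam w)) = w (rh u *m rh v).
Proof.
rewrite (dual_coproduct_sliceL DE) linear_sum mulmx_suml functional_sum.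
apply: eq_bigr => i _; rewrite /= tensfun_tens contractC lmulfE.
by rewrite -scalemxAl functionalZ.
Qed.

(** The threefold product pairs with the iterated coproduct of the unit of
    the dual algebra, and eps is evaluation at that unit.  So weak
    multiplicativity of eps is weak comultiplicativity of the dual unit, tested
    on w1 (x) w2 (x) w3. *)
Lemma dual_weak_counit w1 w2 w3 :
  let F := Dh (rh eps) in
  tensmap Dh id F = leg12 F *m leg23 F ->
  tensmap Dh id F = leg23 F *m leg12 F ->
  eps (lam w1 *m lam w2 *m lam w3)
    = tensfun (fun u => eps (lam w1 *m u)) (fun u => eps (u *m lam w3))
        (D (lam w2)) /\
  eps (lam w1 *m lam w2 *m lam w3)
    = tensfun (fun u => eps (u *m lam w3)) (fun u => eps (lam w1 *m u))
        (D (lam w2)).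
Proof.
move=> F F1 F2.
have epsE : eps (lam w1 *m lam w2 *m lam w3)
    = tensfun w1 w2 (slicer w3 (tensmap Dh id F)).
  rewrite (dual_coproduct_iter DhE) !mulmx_suml functional_sum.
  rewrite [slicer _ _]linear_sum [RHS]linear_sum; apply: eq_bigr => i _ /=.
  rewrite -mulmxA [lam w2 *m _]mulmx_suml mulmx_sumr functional_sum.
  rewrite [slicer _ _]linear_sum [RHS]linear_sum; apply: eq_bigr => j _ /=.
  rewrite [_ *m lam w3]mulmx_sumr mulmx_sumr functional_sum.
  rewrite [slicer _ _]linear_sum [RHS]linear_sum; apply: eq_bigr => k _ /=.
  rewrite mulmxA.
  rewrite [slicer _ _]linearZ /= slicer_tens !tensfunZ tensfun_tens.
  rewrite -!scalemxAl -!scalemxAr -scalemxAl !functionalZ.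
  by rewrite /GRing.scale /=; ring.
have xE u : eps (lam w1 *m u) = lmulf eps (lam w1) u by rewrite lmulfE.
have zE u : eps (u *m lam w3) = rmulf eps (lam w3) u by rewrite rmulfE.
rewrite (eq_tensfun _ xE zE) (eq_tensfun _ zE xE) !tensfun_dual_coproduct.
rewrite -slicel_dual_counit -slicer_dual_counit -/F epsE.
by split; [rewrite F1 tensfun3_leg1223 | rewrite F2 tensfun3_leg2312].
Qed.

End DualPair.
End Contractions.

(** * Units of star-subalgebras *)

Section StarSubalgebras.
Variables (C : numClosedFieldType) (n : nat).
Implicit Types (A : {vspace 'M[C]_n}).

Lemma adjmx_mul_diag (y : 'M[C]_n) i :
  (y^t* *m y) i i = \sum_k `|y k i| ^+ 2.
Proof. by rewrite mxE; apply: eq_bigr => k _; rewrite !mxE mulrC normCK. Qed.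

Lemma sum_adjmx_mul_eq0 (I : finType) (y : I -> 'M[C]_n) :
  \sum_i (y i)^t* *m y i = 0 -> forall i, y i = 0.
Proof.
move=> y0 i; apply/matrixP => k l; rewrite mxE.
have := congr1 (fun M : 'M_n => M l l) y0.
rewrite summxE mxE => /eqP; rewrite psumr_eq0 => [/allP/(_ i)|j _]; last first.
  by rewrite adjmx_mul_diag sumr_ge0 // => p _; rewrite exprn_ge0.
rewrite mem_index_enum => /(_ isT); rewrite adjmx_mul_diag psumr_eq0.
  move=> /allP/(_ k); rewrite mem_index_enum expf_eq0 normr_eq0.
  by move=> /(_ isT)/eqP.
by move=> p _; rewrite exprn_ge0.
Qed.

(** Let h be the sum of the x^t* x over a basis.  By positivity h x = 0
    forces a x = 0 for every a in A, in particular x^t* x = 0 and x = 0.  So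
    left multiplication by h is an injective, hence bijective, endomorphism of
    A; the solution e of h e = h is a left unit, and its adjoint is then a
    right unit. *)
Lemma star_subalgebra_unit A : star_subalgebra A -> exists e, is_unit A e.
Proof.
move=> [Amul Astar]; pose X := vbasis A.
have XA i : X`_i \in A.
  have [ilt|] := ltnP i (size X); last first.
    by move=> /(nth_default 0) ->; exact: mem0v.
  by apply: vbasis_mem; apply: mem_nth.
pose h := \sum_(i < \dim A) (X`_i)^t* *m X`_i.
have hA : h \in A by apply: memv_suml => i _; apply: Amul; rewrite ?Astar.
have hreg x : x \in A -> h *m x = 0 -> x = 0.
  move=> xA hx0.
  have Xx0 (i : 'I_(\dim A)) : X`_i *m x = 0.
    apply: (@sum_adjmx_mul_eq0 _ (fun i : 'I_(\dim A) => X`_i *m x)).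
    transitivity (x^t* *m (h *m x)); last by rewrite hx0 mulmx0.
    rewrite /h mulmx_suml mulmx_sumr.
    by apply: eq_bigr => j _; rewrite adjmxM !mulmxA.
  have Ax0 y : y \in A -> y *m x = 0.
    move=> /coord_vbasis ->; rewrite mulmx_suml big1 // => j _.
    by rewrite -scalemxAl Xx0 scaler0.
  apply: (@sum_adjmx_mul_eq0 'I_1 (fun=> x) _ ord0).
  by rewrite big_ord1 Ax0 // Astar.
pose L := linfun (mulmx h) : 'End('M[C]_n).
have LA : (L @: A)%VS = A.
  apply/eqP; rewrite eqEdim; apply/andP; split.
    apply/subvP => _ /memv_imgP[x xA ->]; rewrite lfunE; exact: Amul.
  rewrite limg_dim_eq //; apply/eqP; rewrite -subv0; apply/subvP => x.
  rewrite memv_cap memv_ker lfunE => /andP[xA /eqP /hreg ->] //; exact: mem0v.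
have := hA; rewrite -{1}LA => /memv_imgP[e eA]; rewrite lfunE /= => he.
have el x : x \in A -> e *m x = x.
  move=> xA; apply/eqP; rewrite -subr_eq0; apply/eqP; apply: hreg.
    by rewrite memvB // Amul.
  by rewrite mulmxBr mulmxA -he subrr.
exists e; split=> // x xA; split; first exact: el.
have ex y : y \in A -> y *m e^t* = y.
  by move=> yA; rewrite -[y]trmxCK -adjmxM el // Astar.
have ee : e^t* = e by rewrite -[LHS]el ?Astar // ex.
by rewrite -{1}ee ex.
Qed.

Lemma unit_self_adjoint A e : star_subalgebra A -> is_unit A e -> e^t* = e.
Proof.
move=> [_ Astar] [eA eu]; have [e1 _] := eu _ (Astar _ eA).
by rewrite -[RHS]trmxCK -[in RHS]e1 adjmxM trmxCK e1.
Qed.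

End StarSubalgebras.

(** * Slicing operators on the triple tensor product *)

Section Legs.
Variables (C : numClosedFieldType) (n : nat).
Implicit Types (w : functional C n) (X Y Z : 'M[C]_(n * n)).

Section Entry.
Variables i k : 'I_n.
Definition entry_fun (Y : 'M[C]_n) : C^o := Y i k.
Lemma entry_linear : linear entry_fun.
Proof. by move=> c X Y; rewrite /entry_fun !mxE. Qed.
HB.instance Definition _ :=
  GRing.isLinear.Build C 'M[C]_n C^o _ entry_fun entry_linear.
Definition entry : functional C n := linfun entry_fun.
Lemma entryE (Y : 'M[C]_n) : entry Y = Y i k.
Proof. by rewrite lfunE. Qed.
End Entry.

Lemma leg12M X Y : leg12 (X *m Y) = leg12 X *m leg12 Y.
Proof. by rewrite /leg12 tensmx_mul mulmx1. Qed.

Lemma leg12_adj X : leg12 (X^t*) = (leg12 X)^t*.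
Proof. by rewrite /leg12 adjmx_tens adjmx1. Qed.

Lemma assoc3M (X Y : 'M[C]_(n * (n * n))) :
  assoc3 (X *m Y) = assoc3 X *m assoc3 Y.
Proof. by rewrite /assoc3; case: _ / (mulnA n n n). Qed.

Lemma assoc3_adj (X : 'M[C]_(n * (n * n))) : assoc3 (X^t*) = (assoc3 X)^t*.
Proof. by rewrite /assoc3; case: _ / (mulnA n n n). Qed.

Lemma leg23M X Y : leg23 (X *m Y) = leg23 X *m leg23 Y.
Proof. by rewrite /leg23 -assoc3M tensmx_mul mulmx1. Qed.

Lemma leg23_adj X : leg23 (X^t*) = (leg23 X)^t*.
Proof. by rewrite /leg23 -assoc3_adj adjmx_tens adjmx1. Qed.

(** The slice by w on the first of three legs; on the third leg, the slice is
    slicer w as such, because 'M_(n * n * n) brackets to the left. *)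
Definition slice1 w (X : 'M[C]_(n * n * n)) : 'M[C]_(n * n) :=
  slicel w (castmx (esym (mulnA n n n), esym (mulnA n n n)) X).

Lemma slice1_linear w : linear (slice1 w).
Proof.
move=> c X Y; rewrite /slice1 -linearP; congr slicel.
by apply/matrixP => i j; rewrite !(castmxE, mxE).
Qed.
HB.instance Definition _ w := GRing.isLinear.Build C 'M[C]_(n * n * n)
  'M[C]_(n * n) _ (slice1 w) (slice1_linear w).

Lemma slice1_assoc3 w (X : 'M[C]_(n * (n * n))) :
  slice1 w (assoc3 X) = slicel w X.
Proof. by rewrite /slice1 /assoc3 castmxK. Qed.

Lemma assoc3_surj (X : 'M[C]_(n * n * n)) :
  exists Y : 'M[C]_(n * (n * n)), X = assoc3 Y.
Proof.
exists (castmx (esym (mulnA n n n), esym (mulnA n n n)) X).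
by rewrite /assoc3 castmxKV.
Qed.

Lemma slicelMl m w (A : 'M[C]_m) (X : 'M[C]_(n * m)) :
  slicel w ((1%:M *t A) *m X) = A *m slicel w X.
Proof.
have [I [f [g ->]]] := tens_decomp X.
rewrite mulmx_sumr [LHS]linear_sum [slicel _ _]linear_sum mulmx_sumr.
apply: eq_bigr => i _; rewrite /= tensmx_mul mul1mx !slicel_tens.
by rewrite scalemxAr.
Qed.

Lemma slicelMr m w (A : 'M[C]_m) (X : 'M[C]_(n * m)) :
  slicel w (X *m (1%:M *t A)) = slicel w X *m A.
Proof.
have [I [f [g ->]]] := tens_decomp X.
rewrite mulmx_suml [LHS]linear_sum [slicel _ _]linear_sum mulmx_suml.
apply: eq_bigr => i _; rewrite /= tensmx_mul mulmx1 !slicel_tens.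
by rewrite scalemxAl.
Qed.

Lemma slicerMl m w (A : 'M[C]_m) (X : 'M[C]_(m * n)) :
  slicer w ((A *t 1%:M) *m X) = A *m slicer w X.
Proof.
have [I [f [g ->]]] := tens_decomp X.
rewrite mulmx_sumr [LHS]linear_sum [slicer _ _]linear_sum mulmx_sumr.
apply: eq_bigr => i _; rewrite /= tensmx_mul mul1mx !slicer_tens.
by rewrite scalemxAr.
Qed.

Lemma slicerMr m w (A : 'M[C]_m) (X : 'M[C]_(m * n)) :
  slicer w (X *m (A *t 1%:M)) = slicer w X *m A.
Proof.
have [I [f [g ->]]] := tens_decomp X.
rewrite mulmx_suml [LHS]linear_sum [slicer _ _]linear_sum mulmx_suml.
apply: eq_bigr => i _; rewrite /= tensmx_mul mulmx1 !slicer_tens.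
by rewrite scalemxAl.
Qed.

Lemma slice1_leg23l w X (Y : 'M[C]_(n * n * n)) :
  slice1 w (leg23 X *m Y) = X *m slice1 w Y.
Proof.
have [Z ->] := assoc3_surj Y.
by rewrite /leg23 -assoc3M !slice1_assoc3 slicelMl.
Qed.

Lemma slice1_leg23r w X (Y : 'M[C]_(n * n * n)) :
  slice1 w (Y *m leg23 X) = slice1 w Y *m X.
Proof.
have [Z ->] := assoc3_surj Y.
by rewrite /leg23 -assoc3M !slice1_assoc3 slicelMr.
Qed.

Lemma slice1_tens w (x y z : 'M[C]_n) :
  slice1 w (x *t y *t z) = w x *: (y *t z).
Proof. by rewrite -assoc3_tens slice1_assoc3 slicel_tens. Qed.

Lemma slice1_leg12 w X : slice1 w (leg12 X) = slicel w X *t 1%:M.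
Proof.
have [I [f [g ->]]] := tens_decomp X.
rewrite [leg12 _]linear_sum [LHS]linear_sum slicel_sum_tens tensmx_suml.
by apply: eq_bigr => i _; rewrite /= slice1_tens tensmxZl.
Qed.

Lemma slice1_leg13 w X : slice1 w (leg13 X) = 1%:M *t slicel w X.
Proof.
have [I [f [g ->]]] := tens_decomp X.
rewrite [leg13 _]linear_sum [LHS]linear_sum slicel_sum_tens tensmx_sumr.
by apply: eq_bigr => i _; rewrite /= leg13_tens slice1_tens tensmxZr.
Qed.

Lemma slice1_leg1213 w X (I : finType) (b a : I -> 'M[C]_n) :
  slice1 w (leg12 X *m leg13 (\sum_i b i *t a i))
    = \sum_i slicel (rmulf w (b i)) X *t a i.
Proof.
have [J [f [g ->]]] := tens_decomp X.
rewrite [leg13 _]linear_sum mulmx_sumr [LHS]linear_sum.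
apply: eq_bigr => i _; rewrite /= slicel_sum_tens [leg12 _]linear_sum.
rewrite mulmx_suml [LHS]linear_sum tensmx_suml; apply: eq_bigr => j _.
by rewrite /= leg13_tens !tensmx_mul mulmx1 mul1mx slice1_tens rmulfE tensmxZl.
Qed.

Lemma slicer_leg12l w X (Y : 'M[C]_(n * n * n)) :
  slicer w (leg12 X *m Y) = X *m slicer w Y.
Proof. exact: slicerMl. Qed.

Lemma slicer_leg12r w X (Y : 'M[C]_(n * n * n)) :
  slicer w (Y *m leg12 X) = slicer w Y *m X.
Proof. exact: slicerMr. Qed.

Lemma slicer_leg23 w X : slicer w (leg23 X) = 1%:M *t slicer w X.
Proof.
have [I [f [g ->]]] := tens_decomp X.
rewrite [leg23 _]linear_sum [LHS]linear_sum slicer_sum_tens tensmx_sumr.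
by apply: eq_bigr => i _; rewrite /= leg23_tens slicer_tens tensmxZr.
Qed.

Lemma slicer_leg13 w X : slicer w (leg13 X) = slicer w X *t 1%:M.
Proof.
have [I [f [g ->]]] := tens_decomp X.
rewrite [leg13 _]linear_sum [LHS]linear_sum slicer_sum_tens tensmx_suml.
by apply: eq_bigr => i _; rewrite /= leg13_tens slicer_tens tensmxZl.
Qed.

Lemma slicer_leg1323 w X (I : finType) (b a : I -> 'M[C]_n) :
  slicer w (leg13 (\sum_i b i *t a i) *m leg23 X)
    = \sum_i b i *t slicer (lmulf w (a i)) X.
Proof.
have [J [f [g ->]]] := tens_decomp X.
rewrite [leg13 _]linear_sum mulmx_suml [LHS]linear_sum.
apply: eq_bigr => i _; rewrite /= slicer_sum_tens [leg23 _]linear_sum.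
rewrite mulmx_sumr [LHS]linear_sum tensmx_sumr; apply: eq_bigr => j _.
rewrite /= leg13_tens leg23_tens !tensmx_mul mulmx1 mul1mx slicer_tens lmulfE.
by rewrite tensmxZr.
Qed.

Lemma slicelM_sum w (J K : finType) (p q : J -> 'M[C]_n) (r s : K -> 'M[C]_n) :
  slicel w ((\sum_j p j *t q j) *m (\sum_k r k *t s k))
    = \sum_j \sum_k w (p j *m r k) *: (q j *m s k).
Proof.
rewrite mulmx_suml linear_sum; apply: eq_bigr => j _.
rewrite mulmx_sumr linear_sum; apply: eq_bigr => k _.
by rewrite /= tensmx_mul slicel_tens.
Qed.

Lemma slicerM_sum w (J K : finType) (p q : J -> 'M[C]_n) (r s : K -> 'M[C]_n) :
  slicer w ((\sum_j q j *t p j) *m (\sum_k s k *t r k))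
    = \sum_j \sum_k w (p j *m r k) *: (q j *m s k).
Proof.
rewrite mulmx_suml linear_sum; apply: eq_bigr => j _.
rewrite mulmx_sumr linear_sum; apply: eq_bigr => k _.
by rewrite /= tensmx_mul slicer_tens.
Qed.

Lemma assoc3_tensmap_Delta V X :
  assoc3 (tensmap id (Delta V) X) = leg23 V *m leg12 X *m (leg23 V)^t*.
Proof.
have [I [f [g ->]]] := tens_decomp X.
rewrite [tensmap _ _ _]linear_sum [LHS]linear_sum [leg12 _]linear_sum.
rewrite mulmx_sumr mulmx_suml; apply: eq_bigr => i _.
rewrite /= tensmap_tensr /leg12 -leg23_adj -assoc3_tens /leg23 -!assoc3M.
by rewrite !tensmx_mul mul1mx mulmx1.
Qed.

Lemma tensmap_Deltah V X :
  tensmap (Deltah V) id X = (leg12 V)^t* *m leg23 X *m leg12 V.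
Proof.
have [I [f [g ->]]] := tens_decomp X.
rewrite [LHS]linear_sum [leg23 _]linear_sum.
rewrite mulmx_sumr mulmx_suml; apply: eq_bigr => i _.
rewrite /= tensmap_tensl -leg12_adj leg23_tens !tensmx_mul.
by rewrite mul1mx mulmx1.
Qed.

Lemma slicel_rmulf m w y (X : 'M[C]_(n * m)) :
  slicel (rmulf w y) X = slicel w (X *m (y *t 1%:M)).
Proof.
have [I [f [g ->]]] := tens_decomp X.
rewrite mulmx_suml [LHS]linear_sum [RHS]linear_sum; apply: eq_bigr => i _.
by rewrite /= tensmx_mul mulmx1 !slicel_tens rmulfE.
Qed.

Lemma slicer_lmulf m w y (X : 'M[C]_(m * n)) :
  slicer (lmulf w y) X = slicer w ((1%:M *t y) *m X).
Proof.
have [I [f [g ->]]] := tens_decomp X.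
rewrite mulmx_sumr [LHS]linear_sum [RHS]linear_sum; apply: eq_bigr => i _.
by rewrite /= tensmx_mul mul1mx !slicer_tens lmulfE.
Qed.

Lemma sliceC w (w' : functional C n) X : w' (slicel w X) = w (slicer w' X).
Proof.
have [I [f [g ->]]] := tens_decomp X.
by rewrite slicel_sum_tens slicer_sum_tens contractC.
Qed.

(** Matrix entries are functionals. *)
Lemma functional_sep (x y : 'M[C]_n) :
  (forall w, w x = w y) -> x = y.
Proof.
move=> E; apply/matrixP => i k.
by have := E (entry i k); rewrite !entryE.
Qed.

End Legs.

(** * The coproducts of the two legs *)

Section MPI.
Variables (C : numClosedFieldType) (n : nat).
Implicit Types (V : 'M[C]_(n * n)) (w : functional C n).

(** Take for the a_i a basis of the right leg.  The coordinates c_i on it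
    extend to functionals on all matrices, and the coefficient of a_i in V is
    rho(c_i), an element of the left leg. *)
Lemma leg_expansion V :
  exists (I : finType) (b a : I -> 'M[C]_n),
    [/\ V = \sum_i b i *t a i, forall i, b i \in left_leg V
      & forall i, a i \in right_leg V].
Proof.
pose A := right_leg V; pose X := vbasis A.
pose c i : functional C n := linfun (coord X i : _ -> C^o).
exists 'I_(\dim A), (fun i => rho V (c i)),
  (fun i : 'I_(\dim A) => X`_i).
split=> [|i|i]; last 1 first.
- by apply: vbasis_mem; apply: mem_nth; rewrite size_tuple.
- apply/matrixP => s t; rewrite summxE.
  case: (mxtens_indexP s) => i j; case: (mxtens_indexP t) => k l.
  pose B := (\matrix_(j', l') V (mxtens_index (i, j')) (mxtens_index (k, l'))).
  (* B is the slice of V by the functional that reads off the entry (i, k). *)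
  have BA : B \in A.
    apply/right_legP.
    exists (entry C i k); apply/matrixP => j' l'.
    by rewrite !mxE entryE mxE.
  transitivity (B j l); first by rewrite mxE.
  rewrite {1}(coord_vbasis BA) summxE; apply: eq_bigr => m _.
  by rewrite tensmxE !mxE lfunE.
- by apply/left_legP; exists (c i).
Qed.

(** Slice V23 V12 V23^t* = V12 V13 on the first leg.  That identity is the
    pentagon equation multiplied by V23^t*, where the second relation turns
    V12 V13 V23 V23^t* into V12 V12^t* V12 V13 = V12 V13. *)
Lemma Delta_dual V (I : finType) (b a : I -> 'M[C]_n) :
  is_MPI V -> V = \sum_i b i *t a i -> dual_coproduct b a (Delta V).
Proof.
move=> [VVV [pent h2 _ _]] hV w; rewrite -slicel_sum_tens -hV.
have E : leg23 V *m leg12 V *m (leg23 V)^t* = leg12 V *m leg13 V.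
  rewrite pent -!mulmxA [leg13 V *m _]mulmxA h2 !mulmxA.
  by rewrite -leg12_adj -!leg12M VVV.
have := congr1 (slice1 w) E.
rewrite -mulmxA slice1_leg23l -leg23_adj slice1_leg23r slice1_leg12 mulmxA.
rewrite /Delta => ->; rewrite {2}hV slice1_leg1213 hV.
under eq_bigr => j _ do rewrite slicel_sum_tens tensmx_suml.
rewrite exchange_big; apply: eq_bigr => i _; apply: eq_bigr => j _.
by rewrite tensmxZl rmulfE.
Qed.

(** Slice V12^t* V23 V12 = V13 V23 on the third leg; this is the pentagon
    equation multiplied by V12^t* and reduced by the second relation. *)
Lemma Deltah_dual V (I : finType) (b a : I -> 'M[C]_n) :
  is_MPI V -> V = \sum_i b i *t a i -> dual_coproduct a b (Deltah V).
Proof.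
move=> [VVV [pent h2 _ _]] hV w; rewrite -slicer_sum_tens -hV.
have E : (leg12 V)^t* *m leg23 V *m leg12 V = leg13 V *m leg23 V.
  rewrite -mulmxA pent !mulmxA -h2 -!mulmxA -leg23_adj -!leg23M.
  by rewrite [V *m _]mulmxA VVV.
have := congr1 (slicer w) E.
rewrite -mulmxA -leg12_adj slicer_leg12l slicer_leg12r slicer_leg23 mulmxA.
rewrite /Deltah => ->; rewrite {1}hV slicer_leg1323 hV.
apply: eq_bigr => i _; rewrite slicer_sum_tens tensmx_sumr.
apply: eq_bigr => j _.
by rewrite tensmxZr lmulfE.
Qed.

(** The relation V12 V23^t* V23 = V23^t* V23 V12, sliced on the first leg,
    says that V^t* V commutes with x (x) 1 for x in the right leg. *)
Lemma Delta_mul V x y : is_MPI V -> x \in right_leg V ->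
  Delta V (x *m y) = Delta V x *m Delta V y.
Proof.
move=> [VVV [_ _ _ h4]] /right_legP[w ->].
have : leg12 V *m leg23 (V^t* *m V) = leg23 (V^t* *m V) *m leg12 V.
  by rewrite leg23M leg23_adj mulmxA h4.
move=> /(congr1 (slice1 w)).
rewrite slice1_leg23r slice1_leg23l slice1_leg12 /Delta => E.
transitivity
  (V *m ((lambda V w *t 1%:M) *m (V^t* *m V)) *m (y *t 1%:M) *m V^t*).
  by rewrite E !mulmxA VVV -[in RHS](mulmxA V) tensmx_mul mulmx1.
by rewrite !mulmxA.
Qed.

(** The relation V12 V12^t* V23 = V23 V12 V12^t*, sliced on the third leg,
    says that V V^t* commutes with 1 (x) y for y in the left leg. *)
Lemma Deltah_mul V x y : is_MPI V -> y \in left_leg V ->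
  Deltah V (x *m y) = Deltah V x *m Deltah V y.
Proof.
move=> [VVV [_ _ h3 _]] /left_legP[w ->].
have : leg12 (V *m V^t*) *m leg23 V = leg23 V *m leg12 (V *m V^t*).
  by rewrite leg12M leg12_adj mulmxA h3.
move=> /(congr1 (slicer w)).
rewrite slicer_leg12l slicer_leg12r slicer_leg23 /Deltah => E.
transitivity
  (V^t* *m (1%:M *t x) *m ((V *m V^t*) *m (1%:M *t rho V w)) *m V).
  rewrite E -!mulmxA [V *m (_ *m V)]mulmxA VVV.
  by rewrite [(1%:M *t x) *m _]mulmxA tensmx_mul mulmx1.
by rewrite !mulmxA.
Qed.

End MPI.

(** * The units of the legs, and the counital maps *)

Section StarLegs.
Variables (C : numClosedFieldType) (n : nat) (V : 'M[C]_(n * n)).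
Variables (I : finType) (b a : I -> 'M[C]_n) (eps epsh : functional C n).
Hypotheses (VMPI : is_MPI V) (hV : V = \sum_i b i *t a i).
Hypotheses (bA : forall i, b i \in left_leg V).
Hypotheses (aA : forall i, a i \in right_leg V).
Hypotheses (Astar : star_subalgebra (right_leg V)).
Hypotheses (Ahstar : star_subalgebra (left_leg V)).
Hypothesis units : unit_functionals V eps epsh.

Implicit Types (w : functional C n).
Local Notation e := (lambda V epsh).
Local Notation eh := (rho V eps).

Lemma lambdaE w : lambda V w = contract b a w.
Proof. by rewrite /lambda {1}hV slicel_sum_tens. Qed.

Lemma rhoE w : rho V w = contract a b w.
Proof. by rewrite /rho {1}hV slicer_sum_tens. Qed.

Lemma adj_expansion : V^t* = \sum_i (b i)^t* *t (a i)^t*.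
Proof.
by rewrite {1}hV adjmx_sum; apply: eq_bigr => i _; rewrite adjmx_tens.
Qed.

Lemma adjVVV : V^t* *m V *m V^t* = V^t*.
Proof. by case: VMPI => VVV _; rewrite -{4}VVV !adjmxM trmxCK mulmxA. Qed.

(** The relation V13 V23 V23^t* = V12^t* V12 V13 sliced on the first leg. *)
Lemma slice_first_leg w : (1%:M *t lambda V w) *m (V *m V^t*)
  = \sum_i slicel (rmulf w (b i)) (V^t* *m V) *t a i.
Proof.
case: VMPI => _ [_ h2 _ _].
have : leg13 V *m leg23 (V *m V^t*) = leg12 (V^t* *m V) *m leg13 V.
  by rewrite leg23M leg23_adj mulmxA h2 -leg12_adj -leg12M.
move=> /(congr1 (slice1 w)); rewrite slice1_leg23r slice1_leg13 => ->.
by rewrite [X in leg13 X]hV slice1_leg1213.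
Qed.

(** The same relation sliced on the third leg. *)
Lemma slice_third_leg w : (V^t* *m V) *m (rho V w *t 1%:M)
  = \sum_i b i *t slicer (lmulf w (a i)) (V *m V^t*).
Proof.
case: VMPI => _ [_ h2 _ _].
have : leg13 V *m leg23 (V *m V^t*) = leg12 (V^t* *m V) *m leg13 V.
  by rewrite leg23M leg23_adj mulmxA h2 -leg12_adj -leg12M.
move=> /(congr1 (slicer w)); rewrite slicer_leg12l slicer_leg13 => <-.
by rewrite [X in leg13 X]hV slicer_leg1323.
Qed.

Lemma unit_mulV : (1%:M *t e) *m V = V.
Proof.
rewrite {2 3}hV mulmx_sumr; apply: eq_bigr => i _.
by case: units => -[_ u] _; rewrite tensmx_mul mul1mx (u _ (aA i)).1.
Qed.

Lemma mulV_unit : V *m (eh *t 1%:M) = V.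
Proof.
rewrite {1 3}hV mulmx_suml; apply: eq_bigr => i _.
by case: units => _ [_ u]; rewrite tensmx_mul mulmx1 (u _ (bA i)).2.
Qed.

Lemma slicel_adjVV_mem w : slicel w (V^t* *m V) \in right_leg V.
Proof.
rewrite adj_expansion [X in _ *m X]hV.
have /= -> := slicelM_sum w (fun i => (b i)^t*) (fun i => (a i)^t*) b a.
apply: memv_suml => i _; apply: memv_suml => j _.
by apply: memvZ; apply: Astar.1; rewrite ?Astar.2.
Qed.

Lemma slicer_VVadj_mem w : slicer w (V *m V^t*) \in left_leg V.
Proof.
rewrite adj_expansion [X in X *m _]hV.
have /= -> := slicerM_sum w a b (fun i => (a i)^t*) (fun i => (b i)^t*).
apply: memv_suml => i _; apply: memv_suml => j _.
by apply: memvZ; apply: Ahstar.1; rewrite ?Ahstar.2.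
Qed.

(** For w = epsh, slice_first_leg expresses V V^t* through elements
    slicel _ (V^t* V), which lie in the right leg.  Hence the unit of the right
    leg fixes the first leg of V V^t*, and with it the first leg of V. *)
Lemma unit_mul_left_leg y : y \in left_leg V -> e *m y = y /\ y *m e = y.
Proof.
case: units => -[eA eu] _; have eadj := unit_self_adjoint Astar (conj eA eu).
have eV : (e *t 1%:M) *m V = V.
  have E : (e *t 1%:M) *m (V *m V^t*) = V *m V^t*.
    have := slice_first_leg epsh; rewrite mulmxA unit_mulV => ->.
    rewrite mulmx_sumr; apply: eq_bigr => i _.
    by rewrite tensmx_mul mul1mx (eu _ (slicel_adjVV_mem _)).1.
  case: VMPI => VVV _; rewrite -{2}VVV mulmxA E; exact: VVV.
have el z : z \in left_leg V -> e *m z = z.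
  by move=> /left_legP[w ->]; rewrite /rho -slicerMl eV.
move=> yA; split; first exact: el.
by rewrite -[RHS]trmxCK -[in RHS](el (y^t*)) ?Ahstar.2 // adjmxM trmxCK eadj.
Qed.

(** The same argument on V^t* V, with slice_third_leg for w = eps. *)
Lemma unit_mul_right_leg x : x \in right_leg V -> eh *m x = x /\ x *m eh = x.
Proof.
case: units => _ [eA eu]; have eadj := unit_self_adjoint Ahstar (conj eA eu).
have eV : V *m (1%:M *t eh) = V.
  have E : (V^t* *m V) *m (1%:M *t eh) = V^t* *m V.
    have := slice_third_leg eps; rewrite -mulmxA mulV_unit => ->.
    rewrite mulmx_suml; apply: eq_bigr => i _.
    by rewrite tensmx_mul mulmx1 (eu _ (slicer_VVadj_mem _)).2.
  case: VMPI => VVV _; rewrite -{1}VVV -!mulmxA [V^t* *m _]mulmxA E.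
  by rewrite mulmxA VVV.
have er z : z \in right_leg V -> z *m eh = z.
  by move=> /right_legP[w ->]; rewrite /lambda -slicelMr eV.
move=> xA; split; last exact: er.
by rewrite -[RHS]trmxCK -[in RHS](er (x^t*)) ?Astar.2 // adjmxM trmxCK eadj.
Qed.

Lemma Delta_unit : Delta V e = V *m V^t*.
Proof.
rewrite /Delta; congr (_ *m _).
rewrite [X in X *m _]hV mulmx_suml [RHS]hV.
apply: eq_bigr => i _; rewrite tensmx_mul mulmx1.
by rewrite (unit_mul_left_leg (bA i)).2.
Qed.

Lemma Deltah_unit : Deltah V eh = V^t* *m V.
Proof.
rewrite /Deltah -mulmxA; congr (_ *m _).
rewrite [X in _ *m X]hV mulmx_sumr [RHS]hV.
apply: eq_bigr => i _; rewrite tensmx_mul mul1mx.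
by rewrite (unit_mul_right_leg (aA i)).1.
Qed.

(** Applying id (x) Delta to E = V V^t* conjugates E12 by V23.  As V23
    commutes with E12, what is left is E12 V23 V23^t* = E12 E23. *)
Lemma weak_unit_right : let E := Delta V e in
  tensmap (Delta V) id E = leg12 E *m leg23 E /\
  tensmap (Delta V) id E = leg23 E *m leg12 E.
Proof.
have c : leg12 (V *m V^t*) *m leg23 V = leg23 V *m leg12 (V *m V^t*).
  by case: VMPI => _ [_ _ h3 _]; rewrite leg12M leg12_adj mulmxA h3.
have cE : tensmap (Delta V) id (Delta V e)
    = leg12 (Delta V e) *m leg23 (Delta V e).
  rewrite {1}lambdaE (dual_coproduct_coassoc (Delta_dual VMPI hV)) -lambdaE.
  rewrite assoc3_tensmap_Delta /= Delta_unit -c.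
  by rewrite [leg23 (V *m _)]leg23M leg23_adj mulmxA.
split=> //; rewrite cE Delta_unit.
have c' : leg12 (V *m V^t*) *m leg23 (V^t*) = leg23 (V^t*) *m leg12 (V *m V^t*).
  have /= := congr1 (fun M => M^t*) c.
  by rewrite !adjmxM -leg12_adj -leg23_adj adjmxM trmxCK => ->.
by rewrite leg23M [LHS]mulmxA c -!mulmxA c'.
Qed.

(** Applying Deltah (x) id to F = V^t* V conjugates F23 by V12, and V12
    commutes with F23. *)
Lemma weak_unit_left : let F := Deltah V eh in
  tensmap (Deltah V) id F = leg12 F *m leg23 F /\
  tensmap (Deltah V) id F = leg23 F *m leg12 F.
Proof.
case: VMPI => _ [_ _ _ h4].
have c : leg23 (V^t* *m V) *m leg12 V = leg12 V *m leg23 (V^t* *m V).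
  by rewrite leg23M leg23_adj -h4 mulmxA.
have c' : leg23 (V^t* *m V) *m leg12 (V^t*) = leg12 (V^t*) *m leg23 (V^t* *m V).
  have /= := congr1 (fun M => M^t*) c.
  by rewrite !adjmxM -leg12_adj -leg23_adj adjmxM trmxCK => ->.
rewrite /= tensmap_Deltah Deltah_unit -leg12_adj; split.
  by rewrite -mulmxA c mulmxA -leg12M.
by rewrite -c' -mulmxA -leg12M.
Qed.

(** By slice_third_leg, the right-hand side is the slice of V V^t* by
    w(1 .) on its second leg, where 1 is the unit of the right leg, and 1 is
    neutral for that leg. *)
Lemma target_left w :
  slicer w (V *m V^t*) = slicel (fun u => epsh (u *m rho V w)) (Deltah V eh).
Proof.
rewrite (@eq_slicel _ _ _ _ (rmulf epsh (rho V w))) => [|u];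
  last by rewrite rmulfE.
rewrite slicel_rmulf Deltah_unit slice_third_leg linear_sum.
transitivity (slicer w ((1%:M *t e) *m (V *m V^t*))).
  by rewrite mulmxA unit_mulV.
rewrite lambdaE tensmx_sumr mulmx_suml [LHS]linear_sum; apply: eq_bigr => i _.
by rewrite /= slicel_tens slicer_lmulf tensmxZr -scalemxAl linearZ.
Qed.

(** By slice_first_leg, the right-hand side is the slice of V^t* V by
    w(. 1) on its first leg, where 1 is the unit of the left leg. *)
Lemma source_right w :
  slicel w (V^t* *m V) = slicer (fun u => eps (lambda V w *m u)) (Delta V e).
Proof.
rewrite (@eq_slicer _ _ _ _ (lmulf eps (lambda V w))) => [|u];
  last by rewrite lmulfE.
rewrite slicer_lmulf Delta_unit slice_first_leg linear_sum.
transitivity (slicel w (V^t* *m V *m (eh *t 1%:M))).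
  by rewrite -mulmxA mulV_unit.
rewrite rhoE tensmx_suml mulmx_sumr [LHS]linear_sum; apply: eq_bigr => i _.
by rewrite /= slicer_tens slicel_rmulf tensmxZl -scalemxAr linearZ.
Qed.

(** Tested on functionals, this is the transpose of target_left. *)
Lemma target_right w :
  slicel w (V *m V^t*) = slicel (fun u => eps (u *m lambda V w)) (Delta V e).
Proof.
apply: functional_sep => w'; rewrite sliceC target_left !lambdaE !rhoE.
by rewrite (target_counit_dual (Delta_dual VMPI hV) (Deltah_dual VMPI hV)).
Qed.

(** The transpose of source_right. *)
Lemma source_left w :
  slicer w (V^t* *m V) = slicer (fun u => epsh (rho V w *m u)) (Deltah V eh).
Proof.
apply: functional_sep => w'; rewrite -sliceC source_right !lambdaE !rhoE.
by rewrite (source_counit_dual (Delta_dual VMPI hV) (Deltah_dual VMPI hV)).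
Qed.

End StarLegs.

(** * Weak Hopf algebras from dual pairs *)

Section DualPairHopf.
Variables (C : numClosedFieldType) (n : nat) (I : finType).
Variables (b a : I -> 'M[C]_n) (D Dh : {linear 'M[C]_n -> 'M[C]_(n * n)}).
Variables (A : {vspace 'M[C]_n}) (eps epsh : functional C n).
Variable S : 'End('M[C]_n).
Implicit Types (w : functional C n).
Local Notation lam := (contract b a).
Local Notation rh := (contract a b).
Local Notation adj f := (fun i => (f i)^t*).
Hypotheses (DE : dual_coproduct b a D) (DhE : dual_coproduct a b Dh).
Hypotheses (Astar : star_subalgebra A) (aA : forall i, a i \in A).
Hypothesis Alam : forall x, x \in A -> exists w, x = lam w.
Hypothesis Aunit : is_unit A (lam epsh).
Hypothesis bunit : forall i, rh eps *m b i = b i /\ b i *m rh eps = b i.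
Hypothesis Dmul : forall x y, x \in A -> y \in A -> D (x *m y) = D x *m D y.
Hypothesis Dadj : forall x, D (x^t*) = (D x)^t*.
Hypothesis weak_unit : let E := D (lam epsh) in
  tensmap D id E = leg12 E *m leg23 E /\ tensmap D id E = leg23 E *m leg12 E.
Hypothesis weak_unit_dual : let F := Dh (rh eps) in
  tensmap Dh id F = leg12 F *m leg23 F /\ tensmap Dh id F = leg23 F *m leg12 F.
Hypothesis S_lam : forall w, S (lam w) = contract (adj b) (adj a) w.
Hypothesis target : forall w,
  \sum_i \sum_j w (b i *m (b j)^t*) *: (a i *m (a j)^t*)
    = slicel (fun u => eps (u *m lam w)) (D (lam epsh)).
Hypothesis source : forall w,
  \sum_i \sum_j w ((b i)^t* *m b j) *: ((a i)^t* *m a j)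
    = slicer (fun u => eps (lam w *m u)) (D (lam epsh)).
Hypothesis normalized : forall w,
  \sum_i \sum_j \sum_k w ((b i)^t* *m b j *m (b k)^t*)
      *: ((a i)^t* *m a j *m (a k)^t*)
    = contract (adj b) (adj a) w.

Lemma memv_lam w : lam w \in A.
Proof. by apply: memv_suml => i _; apply: memvZ. Qed.

Lemma memv_tensv (B B' : {vspace 'M[C]_n}) x y :
  x \in B -> y \in B' -> x *t y \in tensv B B'.
Proof.
move=> /coord_vbasis -> /coord_vbasis ->; rewrite tensmx_suml.
apply: memv_suml => i _; rewrite tensmxZl; apply: memvZ.
rewrite tensmx_sumr; apply: memv_suml => j _; rewrite tensmxZr; apply: memvZ.
apply: memv_span; apply/allpairsP; exists ((vbasis B)`_i, (vbasis B')`_j).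
by split=> //=; apply: mem_nth; rewrite size_tuple.
Qed.

Lemma dual_pair_counital_coalgebra :
  is_counital_coalgebra (HopfData A (lam epsh) D eps S).
Proof.
split=> /= x /Alam[w ->].
- rewrite (dual_coproduct_sliceL DE); apply: memv_suml => i _.
  by apply: memv_tensv; rewrite ?memv_lam.
- exact: dual_coproduct_coassoc.
- by rewrite (dual_coproduct_counitl DE) // => i; case: (bunit i).
- by rewrite (dual_coproduct_counitr DE) // => i; case: (bunit i).
Qed.

(** The coproduct takes its values in the tensor square of the carrier. *)
Lemma unit_absorb w (e := lam epsh) (X := D (lam w)) :
  [/\ (e *t 1%:M) *m X = X, X *m (e *t 1%:M) = X,
      (1%:M *t e) *m X = X & X *m (1%:M *t e) = X].
Proof.
have ue x : x \in A -> e *m x = x /\ x *m e = x by case: Aunit => _; apply.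
rewrite /X; split.
- rewrite (dual_coproduct_sliceL DE) mulmx_sumr; apply: eq_bigr => i _.
  by rewrite tensmx_mul mul1mx (ue _ (aA i)).1.
- rewrite (dual_coproduct_sliceL DE) mulmx_suml; apply: eq_bigr => i _.
  by rewrite tensmx_mul mulmx1 (ue _ (aA i)).2.
- rewrite (dual_coproduct_sliceR DE) mulmx_sumr; apply: eq_bigr => i _.
  by rewrite tensmx_mul mul1mx (ue _ (aA i)).1.
- rewrite (dual_coproduct_sliceR DE) mulmx_suml; apply: eq_bigr => i _.
  by rewrite tensmx_mul mulmx1 (ue _ (aA i)).2.
Qed.

(** The hypothesis weak_unit has the identity matrix where the axiom has the
    unit of the carrier; the difference is absorbed by D(1). *)
Lemma dual_pair_weak_unit (e := lam epsh) :
  tensmap D id (D e) = (D e *t e) *m assoc3 (e *t D e) /\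
  tensmap D id (D e) = assoc3 (e *t D e) *m (D e *t e).
Proof.
have [E12 E21] := weak_unit; have [al ar bl br] := unit_absorb epsh.
pose e3 := leg23 (1%:M *t e); pose e1 := leg12 (e *t 1%:M).
have c13 : e3 *m e1 = e1 *m e3.
  by rewrite /e1 /e3 leg23_tens /leg12 !tensmx_mul !mul1mx !mulmx1.
have l E : E *t e = leg12 E *m e3.
  by rewrite /e3 leg23_tens /leg12 tensmx_mul tensmx11 mul1mx mulmx1.
have l' E : E *t e = e3 *m leg12 E.
  by rewrite /e3 leg23_tens /leg12 tensmx_mul tensmx11 mul1mx mulmx1.
have r E : assoc3 (e *t E) = e1 *m leg23 E.
  rewrite /e1 /leg23 /leg12 -assoc3_tens -assoc3M tensmx_mul tensmx11.
  by rewrite mul1mx mulmx1.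
have r' E : assoc3 (e *t E) = leg23 E *m e1.
  rewrite /e1 /leg23 /leg12 -assoc3_tens -assoc3M tensmx_mul tensmx11.
  by rewrite mul1mx mulmx1.
split.
  rewrite l r E12 -mulmxA [e3 *m _]mulmxA c13 !mulmxA -leg12M ar.
  by rewrite -[RHS]mulmxA -leg23M bl.
rewrite r' l' E21 -mulmxA [e1 *m _]mulmxA -c13 !mulmxA -leg23M br.
by rewrite -[RHS]mulmxA -leg12M al.
Qed.

(** The product of the elements representing the antipode and the identity,
    as a single family, so that it can be convolved once more. *)
Lemma antipode_convolution_id (u : functional C n) :
  mulop (tensmap S id (D (lam u)))
  = contract (fun p : I * I => (b p.1)^t* *m b p.2)
             (fun p => (a p.1)^t* *m a p.2) u.
Proof.
have /= -> := dual_coproduct_convolution DE u (f := S) (g := idfun)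
  (J := I) (K := I) S_lam (fun=> erefl).
by rewrite pair_bigA.
Qed.

Lemma dual_pair_weak_hopf :
  is_weak_hopf_algebra (HopfData A (lam epsh) D eps S).
Proof.
split=> /=.
- split=> //=.
  + by split; [case: Astar | ].
  + exact: dual_pair_counital_coalgebra.
  + exact: dual_pair_weak_unit.
  + move=> x y z /Alam[w1 ->] /Alam[w2 ->] /Alam[w3 ->].
    by have [F1 F2] := weak_unit_dual; apply: (dual_weak_counit DE DhE).
- move=> x /Alam[w ->]; rewrite S_lam; apply: memv_suml => i _.
  by apply: memvZ; apply: Astar.2.
- move=> x /Alam[w ->]; rewrite -target.
  exact: (dual_coproduct_convolution DE w (f := idfun) (g := S)
    (J := I) (K := I) (fun=> erefl) S_lam).
- move=> x /Alam[w ->].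
  by rewrite -source antipode_convolution_id [RHS]pair_bigA.
- move=> x /Alam[w ->].
  (* S(x_1) x_2 S(x_3) is the convolution with S of f, which is S * id. *)
  pose g : {linear 'M[C]_(n * n) -> 'M[C]_n} := @mulop C n \o tensmap S id.
  pose f : {linear 'M[C]_n -> 'M[C]_n} := g \o D.
  transitivity (mulop (tensmap f S (D (lam w)))).
    rewrite (dual_coproduct_sliceL DE) [tensmap D id _]linear_sum.
    rewrite [tensmap f S _]linear_sum; congr mulop.
    rewrite [LHS]linear_sum; apply: eq_bigr => i _.
    by rewrite /= tensmap_tensl (tensmap_tens g) tensmap_tens.
  have /= -> := dual_coproduct_convolution DE w (f := f) (g := S)
    antipode_convolution_id S_lam.
  rewrite S_lam -normalized [RHS]pair_bigA; apply: eq_bigr => p _.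
  by apply: eq_bigr => k _.
Qed.

Lemma dual_pair_cstar_weak_hopf :
  is_cstar_weak_hopf_algebra (HopfData A (lam epsh) D eps S).
Proof.
split=> //=; first exact: dual_pair_weak_hopf.
by exists n, \1%VF; split=> [x y _ _|x _|x _]; rewrite !lfunE.
Qed.

End DualPairHopf.

(** * Pairing and antipodes of the legs *)

Section Evaluation.
Variables (C : numClosedFieldType) (n : nat).
Variables (P : 'Hom('M[C]_n, functional C n)) (f : 'M[C]_n).

Definition eval_fun (x : 'M[C]_n) : C^o := P x f.
Lemma eval_linear : linear eval_fun.
Proof. by move=> c x y; rewrite /eval_fun linearP add_lfunE scale_lfunE. Qed.
HB.instance Definition _ :=
  GRing.isLinear.Build C 'M[C]_n C^o _ eval_fun eval_linear.
(** In the duality axiom the coproduct is tested on bare functions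
    x |-> P x f; this is the same function as a functional. *)
Definition evaluation : functional C n := linfun eval_fun.
Lemma evaluationE x : P x f = evaluation x.
Proof. by rewrite lfunE. Qed.
End Evaluation.

Section Duality.
Variables (C : numClosedFieldType) (n : nat) (V : 'M[C]_(n * n)).
Variables (I : finType) (b a : I -> 'M[C]_n).
Hypotheses (VMPI : is_MPI V) (hV : V = \sum_i b i *t a i).
Hypotheses (bA : forall i, b i \in left_leg V).
Hypotheses (aA : forall i, a i \in right_leg V).
Hypotheses (Astar : star_subalgebra (right_leg V)).
Hypotheses (Ahstar : star_subalgebra (left_leg V)).
Implicit Types (w : functional C n).
Local Notation adj f := (fun i => (f i)^t*).

(** The pairing must be a linear map on all matrices.  A linear right inverse
    of lambda sends an element x of the right leg to a functional w with
    lambda(w) = x, and evaluation of w on the left leg is the pairing with x. *)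
Definition lambda_section : 'Hom('M[C]_n, functional C n) :=
  ((linfun (lambda V))^-1)%VF.
Definition rho_section : 'Hom('M[C]_n, functional C n) :=
  ((linfun (rho V))^-1)%VF.

Lemma lambda_sectionK x : x \in right_leg V -> lambda V (lambda_section x) = x.
Proof. by move=> /limg_lfunVK; rewrite lfunE. Qed.

Lemma rho_sectionK x : x \in left_leg V -> rho V (rho_section x) = x.
Proof. by move=> /limg_lfunVK; rewrite lfunE. Qed.

Lemma lambda_rho (w w' : functional C n) : w' (lambda V w) = w (rho V w').
Proof. exact: sliceC. Qed.

Lemma lambda_mem w : lambda V w \in right_leg V.
Proof. by apply/right_legP; exists w. Qed.

Lemma rho_mem w : rho V w \in left_leg V.
Proof. by apply/left_legP; exists w. Qed.

Lemma slicel_adj w : slicel w (V^t*) = contract (adj b) (adj a) w.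
Proof.
by rewrite (adj_expansion hV) -(slicel_sum_tens (adj b) (adj a)).
Qed.

Lemma slicer_adj w : slicer w (V^t*) = contract (adj a) (adj b) w.
Proof.
by rewrite (adj_expansion hV) -(slicer_sum_tens (adj a) (adj b)).
Qed.

Lemma normal_expansion : V^t* *m V
  = \sum_(p : I * I) ((b p.1)^t* *m b p.2) *t ((a p.1)^t* *m a p.2).
Proof.
rewrite (adj_expansion hV) {1}hV mulmx_suml.
under eq_bigr => i _ do rewrite mulmx_sumr.
by rewrite pair_bigA; apply: eq_bigr => p _; rewrite tensmx_mul.
Qed.

Definition right_antipode : 'End('M[C]_n) :=
  (linfun (lambda (V^t*)) \o lambda_section)%VF.
Definition left_antipode : 'End('M[C]_n) :=
  (linfun (rho (V^t*)) \o rho_section)%VF.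

(** The functional chosen by lambda_section may differ from w, but not on
    the left leg, to which the b_i^t* belong because it is closed under the
    adjoint. *)
Lemma right_antipodeE w : right_antipode (lambda V w) = slicel w (V^t*).
Proof.
rewrite comp_lfunE lfunE /= /lambda !slicel_adj; apply: eq_bigr => i _.
have /left_legP[u ->] := Ahstar.2 _ (bA i).
by rewrite -!lambda_rho lambda_sectionK ?lambda_mem.
Qed.

Lemma left_antipodeE w : left_antipode (rho V w) = slicer w (V^t*).
Proof.
rewrite comp_lfunE lfunE /= /rho !slicer_adj; apply: eq_bigr => i _.
have /right_legP[u ->] := Astar.2 _ (aA i).
by rewrite !lambda_rho rho_sectionK ?rho_mem.
Qed.

Lemma section_pairing : is_leg_pairing V lambda_section.
Proof.
by move=> w w'; rewrite -lambda_rho lambda_sectionK ?lambda_mem.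
Qed.

Variables eps epsh : functional C n.
Hypothesis units : unit_functionals V eps epsh.

Lemma right_leg_hopf :
  is_cstar_weak_hopf_algebra (right_leg_data V eps epsh right_antipode).
Proof.
have lE := lambdaE hV; have rE := rhoE hV.
rewrite /right_leg_data lE.
apply: (dual_pair_cstar_weak_hopf (Delta_dual VMPI hV) (Deltah_dual VMPI hV))
  => //.
- by move=> x /right_legP[w ->]; exists w; rewrite lE.
- by rewrite -lE; case: units.
- by move=> i; rewrite -rE; case: units => _ [_]; apply.
- by move=> x y xA _; apply: Delta_mul.
- move=> x; rewrite /Delta !adjmxM trmxCK adjmx_tens adjmx1 mulmxA //.
- rewrite -lE; exact: (weak_unit_right VMPI hV bA aA Astar Ahstar units).
- rewrite -rE; exact: (weak_unit_left VMPI hV bA aA Astar Ahstar units).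
- by move=> w; rewrite -lE right_antipodeE slicel_adj.
- move=> w; rewrite -!lE -(target_right VMPI hV bA aA Astar Ahstar units).
  rewrite (adj_expansion hV) {1}hV.
  by have /= -> := slicelM_sum w b a (adj b) (adj a).
- move=> w; rewrite -!lE -(source_right VMPI hV bA aA Astar Ahstar units).
  rewrite (adj_expansion hV) {1}hV.
  by have /= -> := slicelM_sum w (adj b) (adj a) b a.
- move=> w; rewrite -slicel_adj -(adjVVV VMPI) normal_expansion.
  rewrite (adj_expansion hV).
  have /= -> := slicelM_sum w (fun p : I * I => (b p.1)^t* *m b p.2)
    (fun p => (a p.1)^t* *m a p.2) (adj b) (adj a).
  by rewrite [LHS]pair_bigA.
Qed.

Lemma left_leg_hopf :
  is_cstar_weak_hopf_algebra (left_leg_data V eps epsh left_antipode).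
Proof.
have lE := lambdaE hV; have rE := rhoE hV.
rewrite /left_leg_data rE.
apply: (dual_pair_cstar_weak_hopf (Deltah_dual VMPI hV) (Delta_dual VMPI hV))
  => //.
- by move=> x /left_legP[w ->]; exists w; rewrite rE.
- by rewrite -rE; case: units.
- by move=> i; rewrite -lE; case: units => -[_ u] _; apply: u.
- by move=> x y _ yA; apply: Deltah_mul.
- by move=> x; rewrite /Deltah !adjmxM trmxCK adjmx_tens adjmx1 mulmxA.
- rewrite -rE; exact: (weak_unit_left VMPI hV bA aA Astar Ahstar units).
- rewrite -lE; exact: (weak_unit_right VMPI hV bA aA Astar Ahstar units).
- by move=> w; rewrite -rE left_antipodeE slicer_adj.
- move=> w; rewrite -!rE -(target_left VMPI hV bA aA Astar Ahstar units).
  rewrite (adj_expansion hV) {1}hV.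
  by have /= -> := slicerM_sum w a b (adj a) (adj b).
- move=> w; rewrite -!rE -(source_left VMPI hV bA aA Astar Ahstar units).
  rewrite (adj_expansion hV) {1}hV.
  by have /= -> := slicerM_sum w (adj a) (adj b) a b.
- move=> w; rewrite -slicer_adj -(adjVVV VMPI) normal_expansion.
  rewrite (adj_expansion hV).
  have /= -> := slicerM_sum w (fun p : I * I => (a p.1)^t* *m a p.2)
    (fun p => (b p.1)^t* *m b p.2) (adj a) (adj b).
  by rewrite [LHS]pair_bigA.
Qed.

Lemma legs_in_duality :
  in_duality lambda_section (right_leg_data V eps epsh right_antipode)
    (left_leg_data V eps epsh left_antipode).
Proof.
have secE x w : x \in right_leg V -> lambda_section x (rho V w) = w x.
  by move=> xA; rewrite -lambda_rho lambda_sectionK.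
have lamE w f : f \in left_leg V -> lambda_section (lambda V w) f = w f.
  by move=> /left_legP[u ->]; rewrite secE ?lambda_mem ?lambda_rho.
split=> /=.
- split=> [x xA x0 | f fA f0].
    by apply: functional_sep => w; rewrite linear0 -(secE x) // x0 ?rho_mem.
  by apply: functional_sep => w; rewrite linear0 -lamE // f0 ?lambda_mem.
- move=> x f g /right_legP[w ->] fA gA.
  have evalK y : y \in left_leg V ->
      contract a b (evaluation lambda_section y) = y.
    move=> /left_legP[u ->]; rewrite [RHS](rhoE hV); apply: eq_bigr => i _.
    by rewrite -evaluationE secE.
  rewrite (eq_tensfun _ (evaluationE _ f) (evaluationE _ g)) (lambdaE hV).
  rewrite (tensfun_dual_coproduct (Delta_dual VMPI hV)) !evalK // -(lambdaE hV).
  by rewrite lamE ?Ahstar.1.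
- move=> x y f xA yA /left_legP[w ->].
  rewrite secE ?Astar.1 // (rhoE hV).
  rewrite (tensfun_dual_coproduct (Deltah_dual VMPI hV)).
  by rewrite -!(lambdaE hV) !lambda_sectionK.
- split=> [x xA|f fA]; first by rewrite secE.
  by rewrite lamE.
- move=> x f /right_legP[w ->] /left_legP[w' ->].
  rewrite left_antipodeE lamE -?left_antipodeE.
    rewrite left_antipodeE right_antipodeE secE ?sliceC //.
    rewrite slicel_adj; apply: memv_suml => i _; apply: memvZ; exact: Astar.2.
  rewrite left_antipodeE slicer_adj.
  by apply: memv_suml => i _; apply: memvZ; apply: Ahstar.2.
Qed.

End Duality.

Theorem proposition4p2 (R : realType) (n : nat) (V : 'M[R[i]]_(n * n))
  (VMPI : is_MPI V)
  (Astar : star_subalgebra (right_leg V))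
  (Ahstar : star_subalgebra (left_leg V)) :
  unital V /\
  exists (S Sh : 'End('M[R[i]]_n)) (P : 'Hom('M[R[i]]_n, functional R[i] n)),
    [/\ forall w : functional R[i] n, S (lambda V w) = slicel w (V^t*),
        forall w : functional R[i] n, Sh (rho V w) = slicer w (V^t*),
        is_leg_pairing V P
      & forall eps epsh : functional R[i] n, unit_functionals V eps epsh ->
        [/\ is_cstar_weak_hopf_algebra (right_leg_data V eps epsh S),
            is_cstar_weak_hopf_algebra (left_leg_data V eps epsh Sh)
          & in_duality P (right_leg_data V eps epsh S)
                         (left_leg_data V eps epsh Sh)]].
Proof.
have [I [b [a [hV bA aA]]]] := leg_expansion V.
split.
  have [e eu] := star_subalgebra_unit Astar.
  have [eh ehu] := star_subalgebra_unit Ahstar.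
  have /right_legP[epsh eE] := eu.1; have /left_legP[eps ehE] := ehu.1.
  by exists eps, epsh; rewrite /unit_functionals -eE -ehE.
exists (right_antipode V), (left_antipode V), (lambda_section V); split.
- by move=> w; apply: (right_antipodeE hV bA Ahstar).
- by move=> w; apply: (left_antipodeE hV aA Astar).
- exact: section_pairing.
move=> eps epsh units; split.
- exact: (right_leg_hopf VMPI hV bA aA Astar Ahstar units).
- exact: (left_leg_hopf VMPI hV bA aA Astar Ahstar units).
- exact: (legs_in_duality VMPI hV bA aA Astar Ahstar).
Qed.
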